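(* Let $\Delta:A_2(0)\to A_2(0)\otimes A_2(0)$ be the unital $*$-homomorphism determined by $\Delta(z_{i,j})=\sum_{k=\min\{i,j\}}^{\max\{i,j\}}z_{i,k}\otimes z_{k,j}$ for $1\le i,j\le 3$. Then $(A_2(0),\Delta)$ is not a compact quantum group.
   Context: **The $C^*$-algebra $A_2(0)$.** It is the universal unital $C^*$-algebra generated by $z_{i,j}$, $1\le i,j\le 3$, subject to the relations: $z_{i,j}z_{i,l}=0$ if $j<l$; $z_{i,j}z_{k,j}=0$ if $i<k$; $z_{i,l}z_{k,j}=z_{k,j}z_{i,l}$ if $i<k$, $j<l$; $z_{i,l}z_{k,j}=0$ if $i<k$, $j<l$, $\max\{i,j\}\ge\min\{k,l\}$; $z_{i,j}z_{k,l}=z_{k,l}z_{i,j}$ if $i<k$, $j<l$, $\max\{i,j\}+1<\min\{k,l\}$; $z_{i,j}z_{k,l}-z_{k,l}z_{i,j}=z_{i,l}z_{k,j}$ if $i<k$, $j<l$, $\max\{i,j\}+1=\min\{k,l\}$; $z_{1,1}z_{2,2}z_{3,3}=1$; $z_{1,1}^*=z_{2,2}z_{3,3}$, $z_{2,2}^*=z_{1,1}z_{3,3}$, $z_{3,3}^*=z_{1,1}z_{2,2}$, $z_{2,1}^*=z_{1,2}z_{3,3}$, $z_{3,2}^*=z_{1,1}z_{2,3}$, $z_{3,1}^*=z_{1,2}z_{2,3}$, $z_{1,2}^*=z_{2,1}z_{3,3}$, $z_{2,3}^*=z_{1,1}z_{3,2}$, $z_{1,3}^*=z_{2,1}z_{3,2}$;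 $z_{i,j}^*z_{r,s}=z_{r,s}z_{i,j}^*$ if $i\ne r$, $j\ne s$. The map $\Delta$ on generators does extend to a unital coassociative $*$-homomorphism; the tensor product is the $C^*$-algebraic tensor product (unique since $A_2(0)$ is of type I). A separable unital $C^*$-algebra $A$ together with a unital $*$-homomorphism $\Delta:A\to A\otimes A$ is called a compact quantum group if (1) $(\Delta\otimes\mathrm{id})\Delta=(\mathrm{id}\otimes\Delta)\Delta$, and (2) the sets $\{(1\otimes a)\Delta(b):a,b\in A\}$ and $\{(a\otimes1)\Delta(b):a,b\in A\}$ are each total (have dense linear span) in $A\otimes A$. *)

(* Defs.v *)
From HB Require Import structures.
From mathcomp Require Import all_boot all_order all_algebra complex.
From mathcomp Require Import all_classical all_reals all_analysis.

Set Implicit Arguments.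
Unset Strict Implicit.
Unset Printing Implicit Defensive.

Import Order.TTheory GRing.Theory Num.Theory.
Import numFieldNormedType.Exports.

Local Open Scope classical_set_scope.
Local Open Scope ring_scope.

(* The library has no join of algebras with normed modules: a normed type that
   is also a ring is forced there to be an ordered domain. So the norm is first
   introduced on a bare algebra, under the name cnorm, and the topology is put on
   a copy of that algebra. An algType is unital and satisfies 1 != 0. *)
HB.mixin Record isCstarNormed (R : realType) A & GRing.Algebra R[i] A := {
  star : A -> A;
  cnorm : A -> R;
  starD : {morph star : x y / x + y};
  starZ : forall (c : R[i]) (x : A), star (c *: x) = c^* *: star x;
  starM : forall x y : A, star (x * y) = star y * star x;
  starK : involutive star;
  cnormD : forall x y : A, cnorm (x + y) <= cnorm x + cnorm y;
  cnormZ : forall (c : R[i]) (x : A), (cnorm (c *: x))%:C%C = `|c| * (cnorm x)%:C%C;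
  cnorm0_eq0 : forall x : A, cnorm x = 0 -> x = 0;
  cnormM : forall x y : A, cnorm (x * y) <= cnorm x * cnorm y;
  cnorm_star_id : forall x : A, cnorm (star x * x) = cnorm x ^+ 2
}.

#[short(type="cstarNormedType")]
HB.structure Definition CstarNormed (R : realType) :=
  {A of GRing.Algebra R[i] A & isCstarNormed R A}.

(* The copy of A carrying the topology of the norm. *)
Definition normed_copy (R : realType) (A : cstarNormedType R) : Type := A.

Section NormedCopy.
Variables (R : realType) (A : cstarNormedType R).

HB.instance Definition _ := GRing.Lmodule.copy (normed_copy A) A.

Let nrm (x : normed_copy A) : R[i] := (cnorm (x : A))%:C%C.

Let nrmD (x y : normed_copy A) : nrm (x + y) <= nrm x + nrm y.
Proof. by rewrite /nrm -rmorphD lecR; exact: cnormD. Qed.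

Let nrmZ (c : R[i]) (x : normed_copy A) : nrm (c *: x) = `|c| * nrm x.
Proof. exact: (@cnormZ R A). Qed.

Let nrm0_eq0 (x : normed_copy A) : nrm x = 0 -> x = 0.
Proof. by move=> [] /(@cnorm0_eq0 R A). Qed.

HB.instance Definition _ :=
  Lmodule_isNormed.Build R[i] (normed_copy A) nrmD nrmZ nrm0_eq0.

End NormedCopy.

HB.mixin Record isCstarComplete (R : realType) A & CstarNormed R A := {
  cstar_complete : forall F : set_system (normed_copy A),
    ProperFilter F -> cauchy F -> cvg F
}.

(* Unital nonzero complex C*-algebras. *)
#[short(type="cstarType")]
HB.structure Definition Cstar (R : realType) :=
  {A of CstarNormed R A & isCstarComplete R A}.

(* Unital *-homomorphisms; they are automatically contractive. *)
Definition star_hom (R : realType) (A B : cstarType R) (f : A -> B) : Prop :=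
  [/\ linear f, monoid_morphism f & {morph f : x / star x}].

Definition lspan (K : pzRingType) (V : lmodType K) (S : set V) : set V :=
  [set x | exists n (c : 'I_n -> K) (s : 'I_n -> V),
     (forall k, S (s k)) /\ x = \sum_k c k *: s k].

Definition cdense (R : realType) (A : cstarType R) (S : set A) : Prop :=
  dense (S : set (normed_copy A)).

Definition linearly_total (R : realType) (A : cstarType R) (S : set A) : Prop :=
  cdense (lspan S).

Definition separable (R : realType) (A : cstarType R) : Prop :=
  exists2 S : set A, countable S & cdense S.

Definition lin_indep (K : pzRingType) (V : lmodType K) n (a : 'I_n -> V) : Prop :=
  forall c : 'I_n -> K, \sum_k c k *: a k = 0 -> forall k, c k = 0.

(* Two *-homomorphisms f, g with commuting ranges induce a *-homomorphism
   a (x) b |-> f a * g b from the algebraic tensor product of A and B to D.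
   The last clause is its injectivity: each element of the algebraic tensor
   product is a sum of a_k (x) b_k with (a_k) linearly independent, and such a
   sum is zero iff all the b_k are. Pulling back the norm of such a D gives a
   C*-norm on the algebraic tensor product, and each C*-norm arises this way. *)
Definition tensor_embedding (R : realType) (A B D : cstarType R)
    (f : A -> D) (g : B -> D) : Prop :=
  [/\ star_hom f, star_hom g, (forall a b, f a * g b = g b * f a) &
      forall n (a : 'I_n -> A) (b : 'I_n -> B), lin_indep a ->
        \sum_k f (a k) * g (b k) = 0 -> forall k, b k = 0].

(* T, with i a = a (x) 1 and j b = 1 (x) b, is the C*-tensor product of A and
   B: the completion of their algebraic tensor product in its unique C*-norm.
   The third clause is the uniqueness; it holds whenever A or B is of type I.
   No choice between the minimal and the maximal C*-norm is made. *)
Definition is_tensor (R : realType) (A B T : cstarType R)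
    (i : A -> T) (j : B -> T) : Prop :=
  [/\ tensor_embedding i j,
      linearly_total [set i a * j b | a in [set: A] & b in [set: B]] &
      forall (D : cstarType R) (f : A -> D) (g : B -> D),
        tensor_embedding f g ->
        forall n (a : 'I_n -> A) (b : 'I_n -> B),
          cnorm (\sum_k f (a k) * g (b k)) = cnorm (\sum_k i (a k) * j (b k))].

(* (Delta (x) id) Delta = (id (x) Delta) Delta, with T = A (x) A. Here T3, p, q
   is T (x) A, and r : a (x) b |-> 1 (x) a (x) b embeds T in T3 as the last two
   legs, so that (fun a => p (i a)) and r exhibit T3 as A (x) T as well. Then
   F is Delta (x) id and G is id (x) Delta. *)
Definition coassociative (R : realType) (A T : cstarType R)
    (i j Delta : A -> T) : Prop :=
  forall (T3 : cstarType R) (p : T -> T3) (q : A -> T3) (r F G : T -> T3),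
    is_tensor p q -> star_hom r -> star_hom F -> star_hom G ->
    (forall a, r (i a) = p (j a)) -> (forall a, r (j a) = q a) ->
    (forall a, F (i a) = p (Delta a)) -> (forall a, F (j a) = q a) ->
    (forall a, G (i a) = p (i a)) -> (forall a, G (j a) = r (Delta a)) ->
    forall a, F (Delta a) = G (Delta a).

(* i a = a (x) 1 and j a = 1 (x) a are the embeddings of A in T = A (x) A. *)
Definition compact_quantum_group (R : realType) (A T : cstarType R)
    (i j Delta : A -> T) : Prop :=
  [/\ separable A,
      star_hom Delta,
      coassociative i j Delta,
      linearly_total [set j a * Delta b | a in [set: A] & b in [set: A]] &
      linearly_total [set i a * Delta b | a in [set: A] & b in [set: A]]].

(* Indices are shifted: the mathematical z_{i,j}, 1 <= i, j <= 3, is stored at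
   position (i - 1, j - 1). All index conditions are invariant under the shift. *)
Definition ix1 : 'I_3 := @Ordinal 3 0 isT.
Definition ix2 : 'I_3 := @Ordinal 3 1 isT.
Definition ix3 : 'I_3 := @Ordinal 3 2 isT.

Record A20_relations (R : realType) (A : cstarType R) (z : 'M[A]_3) : Prop := {
  A20_row : forall i j l : 'I_3, (j < l)%N -> z i j * z i l = 0;
  A20_col : forall i j k : 'I_3, (i < k)%N -> z i j * z k j = 0;
  A20_anti : forall i j k l : 'I_3, (i < k)%N -> (j < l)%N ->
    z i l * z k j = z k j * z i l;
  A20_anti0 : forall i j k l : 'I_3, (i < k)%N -> (j < l)%N ->
    (maxn i j >= minn k l)%N -> z i l * z k j = 0;
  A20_far : forall i j k l : 'I_3, (i < k)%N -> (j < l)%N ->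
    ((maxn i j).+1 < minn k l)%N -> z i j * z k l = z k l * z i j;
  A20_near : forall i j k l : 'I_3, (i < k)%N -> (j < l)%N ->
    (maxn i j).+1 = minn k l ->
    z i j * z k l - z k l * z i j = z i l * z k j;
  A20_det : z ix1 ix1 * z ix2 ix2 * z ix3 ix3 = 1;
  A20_star11 : star (z ix1 ix1) = z ix2 ix2 * z ix3 ix3;
  A20_star22 : star (z ix2 ix2) = z ix1 ix1 * z ix3 ix3;
  A20_star33 : star (z ix3 ix3) = z ix1 ix1 * z ix2 ix2;
  A20_star21 : star (z ix2 ix1) = z ix1 ix2 * z ix3 ix3;
  A20_star32 : star (z ix3 ix2) = z ix1 ix1 * z ix2 ix3;
  A20_star31 : star (z ix3 ix1) = z ix1 ix2 * z ix2 ix3;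
  A20_star12 : star (z ix1 ix2) = z ix2 ix1 * z ix3 ix3;
  A20_star23 : star (z ix2 ix3) = z ix1 ix1 * z ix3 ix2;
  A20_star13 : star (z ix1 ix3) = z ix2 ix1 * z ix3 ix2;
  A20_starC : forall i j r s : 'I_3, i != r -> j != s ->
    star (z i j) * z r s = z r s * star (z i j)
}.

(* (A, z) is the universal unital C*-algebra A_2(0) with its generators. *)
Definition is_A20 (R : realType) (A : cstarType R) (z : 'M[A]_3) : Prop :=
  A20_relations z /\
  forall (D : cstarType R) (w : 'M[D]_3), A20_relations w ->
    exists! f : A -> D, star_hom f /\ forall i j, f (z i j) = w i j.

(* Main.v *)
From HB Require Import structures.
Require Import Defs.
From mathcomp Require Import all_boot all_order all_algebra complex finmap.
From mathcomp Require Import all_classical all_reals all_analysis.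
From mathcomp Require Import ring lra.

Set Implicit Arguments.
Unset Strict Implicit.
Unset Printing Implicit Defensive.

Import Order.TTheory GRing.Theory Num.Theory.
Import numFieldNormedType.Exports.

Local Open Scope classical_set_scope.
Local Open Scope ring_scope.

(** Setting z13, z23, z31, z32 to 0 and z33 to 1 gives a quotient of A_2(0), the
    algebra of SU_q(2) at q = 0: it is generated by a and b, the images of z11
    and z12, with a a^* = 1, a^* a + b b^* = 1, b normal and a b = a b^* = 0,
    and z21, z22 go to b^*, a^* ([su0_relations]). On l2(N x Z x N), with basis
    vectors e(i,k,j), this gives two representations: in p1, a lowers i and b
    sends e(0,k,j) to e(0,k+1,j), killing the vectors with i > 0; in p2, a lowers
    j and b is the projection on j = 0. They commute, so they define a
    representation P of the tensor product T with P(x (x) y) = p1(x) p2(y).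

    The composite P Delta leaves invariant the closed span of the e(i,k,j) with
    k = max(j - i, 0), the cyclic subspace of e(0,0,0). Moreover p2 leaves
    invariant the closed span of the e(0,-1,j), and those vectors are not of
    the first kind. So, with O and Q the two projections,
    Q P((1 (x) x) Delta(y)) O = p2(x) Q O P(Delta(y)) = 0 for all x and y.
    This persists on the closed linear span of the (1 (x) x) Delta(y), but fails
    for z12^* (x) 1, as p1 sends z12^* to b^*, which maps e(0,0,0) to e(0,-1,0).
    Hence that span is not dense.

    Two facts about all elements, not just generators, carry the argument. First
    ([A20_commute]), an operator commuting with the images of the generators
    commutes with the whole image of A_2(0): the operators commuting with it and
    having an adjoint that does too form a C*-algebra, so universality yields a
    map into that algebra, equal to the given one by uniqueness. This gives
    the commutation of p1 and p2 and both invariant subspaces. Secondly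
    ([tensor_universal]), uniqueness of the C*-norm forces T to be the maximal
    tensor product: compare T with the subalgebra of T x B(H) generated by the
    (i x, p1 x) and the (j y, p2 y). *)

(** * Hilbert spaces *)

(** [hdot] is the real part of the inner product. It suffices for complex-linear
    operators: their adjoints for [hdot] and for the complex inner product
    agree, and [hdot] avoids complex-valued limits. *)
HB.mixin Record isHilbert (R : realType) H & GRing.Lmodule R[i] H := {
  hdot : H -> H -> R;
  hdotC : forall x y, hdot x y = hdot y x;
  hdotDl : forall x y z, hdot (x + y) z = hdot x z + hdot y z;
  hdotZ : forall (c : R[i]) x y, hdot (c *: x) y = hdot x (c^* *: y);
  hdotZr : forall (r : R) x y, hdot (r%:C%C *: x) y = r * hdot x y;
  hdot_ge0 : forall x, 0 <= hdot x x;
  hdot_eq0 : forall x, hdot x x = 0 -> x = 0;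
  hilbert_nontrivial : exists x : H, x != 0;
  hilbert_complete : forall u : nat -> H,
    (forall e, 0 < e -> exists N, forall m n, (N <= m)%N -> (N <= n)%N ->
       hdot (u m - u n) (u m - u n) < e) ->
    exists l, forall e, 0 < e -> exists N, forall n, (N <= n)%N ->
      hdot (u n - l) (u n - l) < e
}.

#[short(type="hilbertType")]
HB.structure Definition Hilbert (R : realType) :=
  {H of GRing.Lmodule R[i] H & isHilbert R H}.

Section HilbertTheory.
Variables (R : realType) (H : hilbertType R).
Implicit Types (x y z : H) (c : R[i]) (r : R).

Lemma hdotDr x y z : hdot x (y + z) = hdot x y + hdot x z.
Proof. by rewrite hdotC hdotDl !(hdotC x). Qed.

Lemma hdot0l x : hdot 0 x = 0.
Proof. by apply: (addrI (hdot 0 x)); rewrite -hdotDl !addr0. Qed.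

Lemma hdot0r x : hdot x 0 = 0. Proof. by rewrite hdotC hdot0l. Qed.

Lemma hdotNl x y : hdot (- x) y = - hdot x y.
Proof. by apply/eqP; rewrite -addr_eq0 -hdotDl addNr hdot0l. Qed.

Lemma hdotNr x y : hdot x (- y) = - hdot x y.
Proof. by rewrite hdotC hdotNl hdotC. Qed.

Lemma hdotBl x y z : hdot (x - y) z = hdot x z - hdot y z.
Proof. by rewrite hdotDl hdotNl. Qed.

Lemma hdotBr x y z : hdot x (y - z) = hdot x y - hdot x z.
Proof. by rewrite hdotDr hdotNr. Qed.

Lemma hdot_nondeg x y : (forall z, hdot x z = hdot y z) -> x = y.
Proof.
move=> xy; apply/eqP; rewrite -subr_eq0; apply/eqP/hdot_eq0.
by rewrite hdotBl xy subrr.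
Qed.

Definition hnorm x := Num.sqrt (hdot x x).

Lemma hnorm_ge0 x : 0 <= hnorm x. Proof. exact: sqrtr_ge0. Qed.

Lemma hnormE x : hnorm x ^+ 2 = hdot x x.
Proof. by rewrite sqr_sqrtr // hdot_ge0. Qed.

Lemma hdot_le_sqr x y : hdot x y ^+ 2 <= hdot x x * hdot y y.
Proof.
have h r : 0 <= hdot x x - r * hdot x y *+ 2 + r ^+ 2 * hdot y y.
  have := hdot_ge0 (x - r%:C%C *: y).
  rewrite hdotBl !hdotBr !hdotZr !(hdotC _ (_ *: y)) !hdotZr.
  by rewrite (hdotC y x) => h; nra.
have [y0|y0] := eqVneq (hdot y y) 0.
  rewrite y0 mulr0; have -> : y = 0 by exact: hdot_eq0.
  by rewrite hdot0r expr0n.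
have yp : 0 < hdot y y by rewrite lt_neqAle eq_sym y0 hdot_ge0.
have := h (hdot x y / hdot y y); rewrite -(ler_pM2r yp) mul0r.
suff -> : (hdot x x - hdot x y / hdot y y * hdot x y *+ 2 +
   (hdot x y / hdot y y) ^+ 2 * hdot y y) * hdot y y =
   hdot x x * hdot y y - hdot x y ^+ 2 by rewrite subr_ge0.
by field.
Qed.

Lemma hdot_le x y : hdot x y <= hnorm x * hnorm y.
Proof.
rewrite (le_trans (ler_norm _)) // -sqrtr_sqr -sqrtrM ?hdot_ge0 //.
by rewrite ler_wsqrtr // hdot_le_sqr.
Qed.

Lemma hnorm_triangle x y : hnorm (x + y) <= hnorm x + hnorm y.
Proof.
rewrite -(@ler_pXn2r _ 2) ?nnegrE ?addr_ge0 ?hnorm_ge0 //.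
rewrite hnormE hdotDl !hdotDr (hdotC y x) sqrrD !hnormE.
by have := hdot_le x y; lra.
Qed.

Lemma conjc_mulE c : c^* * c = (complex.Re c ^+ 2 + complex.Im c ^+ 2)%:C%C.
Proof. by rewrite mulrC -normCK -add_Re2_Im2. Qed.

(** Real-valued version of the norm of C, which takes its values in C. *)
Definition cabs c : R := Num.sqrt (complex.Re c ^+ 2 + complex.Im c ^+ 2).

Lemma cabsE c : (cabs c)%:C%C = `|c|. Proof. by rewrite normc_def. Qed.

Lemma cabs_ge0 c : 0 <= cabs c. Proof. exact: sqrtr_ge0. Qed.

Lemma hnormZ c x : hnorm (c *: x) = cabs c * hnorm x.
Proof.
rewrite /hnorm hdotZ scalerA conjc_mulE hdotC hdotZr sqrtrM //.
by rewrite addr_ge0 // sqr_ge0.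
Qed.

Lemma hnormN x : hnorm (- x) = hnorm x.
Proof. by rewrite /hnorm hdotNl hdotNr opprK. Qed.

Lemma hnorm0 : hnorm 0 = 0. Proof. by rewrite /hnorm hdot0l sqrtr0. Qed.

Lemma hnorm_eq0 x : hnorm x = 0 -> x = 0.
Proof. by move=> x0; apply: hdot_eq0; rewrite -hnormE x0 expr0n. Qed.

Lemma hnorm_complete (u : nat -> H) :
  (forall e, 0 < e -> exists N, forall m n, (N <= m)%N -> (N <= n)%N ->
     hnorm (u m - u n) < e) ->
  exists l, forall e, 0 < e -> exists N, forall n, (N <= n)%N ->
    hnorm (u n - l) < e.
Proof.
move=> uc; have [e e0|l ul] := @hilbert_complete R H u.
  have [|N uN] := uc (Num.sqrt e); first by rewrite sqrtr_gt0.
  exists N => m n Nm Nn; rewrite -hnormE -(sqr_sqrtr (ltW e0)).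
  by rewrite ltr_pXn2r ?nnegrE ?hnorm_ge0 ?sqrtr_ge0 // uN.
exists l => e e0; have [|N uN] := ul (e ^+ 2); first by rewrite exprn_gt0.
exists N => n /uN; rewrite -hnormE ltr_pXn2r ?nnegrE ?hnorm_ge0 // ltW //.
Qed.

End HilbertTheory.

(** * Adjointable operators and commutants *)

Section AdjointableOperators.
Variables (R : realType) (H : hilbertType R).

(** Additivity is not a field: it follows from having an adjoint. Homogeneity is
    one because [hdot] is only real bilinear. *)
Record adjop := AdjOp {
  afun :> H -> H;
  aadj : H -> H;
  afunZ : forall (c : R[i]) x, afun (c *: x) = c *: afun x;
  aadjP : forall x y, hdot (afun x) y = hdot x (aadj y)
}.

Lemma adjop_eq (S T : adjop) : (forall x, S x = T x) -> S = T.
Proof.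
case: S T => [s s' sZ sP] [t t' tZ tP] /= st.
have ? : s = t by exact/funext.
subst t; have ? : s' = t'.
  by apply/funext => y; apply: hdot_nondeg => x; rewrite hdotC -sP tP hdotC.
by subst t'; congr AdjOp; exact: Prop_irrelevance.
Qed.

Lemma aadjP' (T : adjop) x y : hdot (aadj T x) y = hdot x (T y).
Proof. by rewrite hdotC -aadjP hdotC. Qed.

Lemma afunD (T : adjop) x y : T (x + y) = T x + T y.
Proof. by apply: hdot_nondeg => z; rewrite hdotDl !aadjP hdotDl. Qed.

Lemma afun0 (T : adjop) : T 0 = 0.
Proof. by apply: (addrI (T 0)); rewrite -afunD !addr0. Qed.

Lemma aadjZ (T : adjop) (c : R[i]) x : aadj T (c *: x) = c *: aadj T x.
Proof.
by apply: hdot_nondeg => z; rewrite aadjP' hdotZ -afunZ -aadjP' hdotZ.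
Qed.

Fact add_subproof (S T : adjop) x y :
  hdot (S x + T x) y = hdot x (aadj S y + aadj T y).
Proof. by rewrite hdotDl hdotDr !aadjP. Qed.

Fact addZ_subproof (S T : adjop) (c : R[i]) x :
  S (c *: x) + T (c *: x) = c *: (S x + T x).
Proof. by rewrite !afunZ scalerDr. Qed.

Definition adj_add S T := AdjOp (@addZ_subproof S T) (@add_subproof S T).

Fact scale_subproof (c : R[i]) (T : adjop) x y :
  hdot (c *: T x) y = hdot x (c^* *: aadj T y).
Proof. by rewrite hdotZ aadjP aadjZ. Qed.

Fact scaleZ_subproof (c : R[i]) (T : adjop) (d : R[i]) x :
  c *: T (d *: x) = d *: (c *: T x).
Proof. by rewrite afunZ !scalerA mulrC. Qed.

Definition adj_scale c T := AdjOp (@scaleZ_subproof c T) (@scale_subproof c T).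

Fact mul_subproof (S T : adjop) x y :
  hdot (S (T x)) y = hdot x (aadj T (aadj S y)).
Proof. by rewrite !aadjP. Qed.

Fact mulZ_subproof (S T : adjop) (c : R[i]) x : S (T (c *: x)) = c *: S (T x).
Proof. by rewrite !afunZ. Qed.

Definition adj_mul S T := AdjOp (@mulZ_subproof S T) (@mul_subproof S T).

Definition adj_one : adjop :=
  @AdjOp id id (fun _ _ => erefl) (fun _ _ => erefl).

Fact zero_subproof (x y : H) : hdot (0 : H) y = hdot x 0.
Proof. by rewrite hdot0l hdot0r. Qed.

Definition adj_zero : adjop :=
  @AdjOp (fun=> 0) (fun=> 0) (fun c _ => esym (scaler0 _ c)) zero_subproof.

Definition adj_star (T : adjop) : adjop := AdjOp (aadjZ T) (aadjP' T).

HB.instance Definition _ := gen_eqMixin adjop.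
HB.instance Definition _ := gen_choiceMixin adjop.

Fact adj_addA : associative adj_add.
Proof. by move=> S T U; apply: adjop_eq => x /=; rewrite addrA. Qed.
Fact adj_addC : commutative adj_add.
Proof. by move=> S T; apply: adjop_eq => x /=; rewrite addrC. Qed.
Fact adj_add0 : left_id adj_zero adj_add.
Proof. by move=> S; apply: adjop_eq => x /=; rewrite add0r. Qed.
Fact adj_addN : left_inverse adj_zero (adj_scale (-1)) adj_add.
Proof. by move=> S; apply: adjop_eq => x /=; rewrite scaleN1r addNr. Qed.

HB.instance Definition _ :=
  GRing.isZmodule.Build adjop adj_addA adj_addC adj_add0 adj_addN.

Fact adj_mulA : associative adj_mul.
Proof. by move=> S T U; apply: adjop_eq. Qed.
Fact adj_mul1l : left_id adj_one adj_mul.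
Proof. by move=> S; apply: adjop_eq. Qed.
Fact adj_mul1r : right_id adj_one adj_mul.
Proof. by move=> S; apply: adjop_eq. Qed.
Fact adj_mulDl : left_distributive adj_mul +%R.
Proof. by move=> S T U; apply: adjop_eq. Qed.
Fact adj_mulDr : right_distributive adj_mul +%R.
Proof. by move=> S T U; apply: adjop_eq => x /=; rewrite afunD. Qed.
Fact adj_one_neq0 : adj_one != 0.
Proof.
have [x x0] := @hilbert_nontrivial R H.
by apply: contra_neq x0 => /(congr1 (fun T : adjop => T x)).
Qed.

HB.instance Definition _ := GRing.Zmodule_isNzRing.Build adjop
  adj_mulA adj_mul1l adj_mul1r adj_mulDl adj_mulDr adj_one_neq0.

Fact adj_scaleA a b T : adj_scale a (adj_scale b T) = adj_scale (a * b) T.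
Proof. by apply: adjop_eq => x /=; rewrite scalerA. Qed.
Fact adj_scale1 : left_id 1 adj_scale.
Proof. by move=> T; apply: adjop_eq => x /=; rewrite scale1r. Qed.
Fact adj_scaleDr : right_distributive adj_scale +%R.
Proof. by move=> a S T; apply: adjop_eq => x /=; rewrite scalerDr. Qed.
Fact adj_scaleDl T : {morph adj_scale^~ T : a b / a + b}.
Proof. by move=> a b; apply: adjop_eq => x /=; rewrite scalerDl. Qed.

HB.instance Definition _ := GRing.Zmodule_isLmodule.Build R[i] adjop
  adj_scaleA adj_scale1 adj_scaleDr adj_scaleDl.

Fact adj_scaleAl (a : R[i]) (S T : adjop) : a *: (S * T) = (a *: S) * T.
Proof. exact: adjop_eq. Qed.

HB.instance Definition _ :=
  GRing.Lmodule_isLalgebra.Build R[i] adjop adj_scaleAl.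

Fact adj_scaleAr (a : R[i]) (S T : adjop) : a *: (S * T) = S * (a *: T).
Proof. by apply: adjop_eq => x; rewrite /= afunZ. Qed.

HB.instance Definition _ :=
  GRing.Lalgebra_isAlgebra.Build R[i] adjop adj_scaleAr.

Lemma adj_starK : involutive adj_star.
Proof. by move=> T; apply: adjop_eq. Qed.
Lemma adj_starD : {morph adj_star : S T / S + T}.
Proof. by move=> S T; apply: adjop_eq. Qed.
Lemma adj_starM S T : adj_star (S * T) = adj_star T * adj_star S.
Proof. exact: adjop_eq. Qed.
Lemma adj_starZ (c : R[i]) T : adj_star (c *: T) = c^* *: adj_star T.
Proof. exact: adjop_eq. Qed.
Lemma adj_star1 : adj_star 1 = 1.
Proof. exact: adjop_eq. Qed.
Lemma adj_star0 : adj_star 0 = 0.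
Proof. exact: adjop_eq. Qed.

Definition bounded_op (T : adjop) := exists M, forall x, hnorm (T x) <= M * hnorm x.

Lemma bounded_op_ge0 (T : adjop) : bounded_op T ->
  exists2 M, 0 <= M & forall x, hnorm (T x) <= M * hnorm x.
Proof.
move=> [M TM]; exists `|M| => // x; rewrite (le_trans (TM x)) //.
by rewrite ler_wpM2r ?hnorm_ge0 // ler_norm.
Qed.

Lemma bounded_op_star_le (T : adjop) M : 0 <= M -> (forall x, hnorm (T x) <= M * hnorm x) ->
  forall x, hnorm (adj_star T x) <= M * hnorm x.
Proof.
move=> M0 TM x; have [->|y0] := eqVneq (hnorm (adj_star T x)) 0.
  by rewrite mulr_ge0 // hnorm_ge0.
have yp : 0 < hnorm (adj_star T x) by rewrite lt_neqAle eq_sym y0 hnorm_ge0.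
rewrite -(ler_pM2r yp) -expr2 hnormE /= aadjP' (le_trans (hdot_le _ _)) //.
by rewrite mulrAC [_ * hnorm x]mulrC ler_wpM2l ?hnorm_ge0.
Qed.

Variable c : adjop.

(** The condition on the adjoint makes this set star-closed for every c. For c = 1
    it consists of all bounded adjointable operators. *)
Definition in_commutant (T : adjop) : bool :=
  `[< [/\ bounded_op T, T * c = c * T & adj_star T * c = c * adj_star T] >].

Fact in_commutant_closed : GRing.subsemialg_closed in_commutant.
Proof.
split.
- apply/asboolP; rewrite adj_star1 !mul1r !mulr1; split => //.
  by exists 1 => x; rewrite mul1r.
- split; first apply/asboolP.
    rewrite adj_star0 !mul0r !mulr0; split => //; exists 0 => x.
    by rewrite mul0r hnorm0.
  move=> S T /asboolP[[M SM] S1 S2] /asboolP[[N TN] T1 T2]; apply/asboolP.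
  rewrite adj_starD !mulrDl !mulrDr S1 S2 T1 T2; split => //; exists (M + N) => x.
  by rewrite mulrDl (le_trans (hnorm_triangle _ _)) // lerD.
- move=> a T /asboolP[[N TN] T1 T2]; apply/asboolP.
  rewrite adj_starZ -!scalerAl -!scalerAr T1 T2; split => //; exists (cabs a * N) => x.
  by rewrite hnormZ -mulrA ler_wpM2l ?cabs_ge0.
- move=> S T /asboolP[/bounded_op_ge0[M M0 SM] S1 S2] /asboolP[[N TN] T1 T2].
  apply/asboolP; rewrite adj_starM -!mulrA T1 S2 !mulrA S1 T2.
  split => //; exists (M * N) => x.
  by rewrite -mulrA (le_trans (SM _)) // ler_wpM2l.
Qed.

HB.instance Definition _ :=
  GRing.isSubalgClosed.Build R[i] adjop in_commutant in_commutant_closed.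

Record commutant := Commutant { opval : adjop; _ : in_commutant opval }.

HB.instance Definition _ := [isSub for opval].
HB.instance Definition _ := [Choice of commutant by <:].
HB.instance Definition _ := [SubChoice_isSubAlgebra of commutant by <:].

End AdjointableOperators.

(** * Completeness through sequences *)

Section SequentialCompleteness.
Variables (R : realType).

Definition seq_cauchy (A : cstarNormedType R) (u : nat -> A) :=
  forall e : R, 0 < e -> exists N, forall m n, (N <= m)%N -> (N <= n)%N ->
    cnorm (u m - u n) < e.

Definition seq_limit (A : cstarNormedType R) (u : nat -> A) (l : A) :=
  forall e : R, 0 < e -> exists N, forall n, (N <= n)%N -> cnorm (u n - l) < e.

Lemma normed_copy_ball (A : cstarNormedType R) (x y : A) (e : R) :
  ball (x : normed_copy A) e%:C%C y <-> cnorm (x - y) < e.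
Proof. by rewrite -ball_normE /ball_ /= -(ltcR (cnorm (x - y))). Qed.

Lemma gt0_real (e : R[i]) : 0 < e -> exists2 r : R, 0 < r & e = r%:C%C.
Proof.
case: e => a b; rewrite ltcE /= => /andP[/eqP -> a0]; exists a => //.
Qed.

Lemma cnormN (A : cstarNormedType R) (x : A) : cnorm (- x) = cnorm x.
Proof.
apply: (@complexI R); rewrite -scaleN1r cnormZ normrN normr1 mul1r //.
Qed.

Lemma cnorm0 (A : cstarNormedType R) : cnorm (0 : A) = 0.
Proof. by apply: (@complexI R); rewrite -(scale0r 0) cnormZ normr0 mul0r. Qed.

Lemma cnorm_ge0 (A : cstarNormedType R) (x : A) : 0 <= cnorm x.
Proof.
have := cnormD x (- x); rewrite subrr cnorm0 cnormN => h.
by rewrite -(pmulr_rge0 _ (ltr0n R 2)) mulr_natl mulr2n.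
Qed.

Lemma cnorm_distC (A : cstarNormedType R) (x y : A) :
  cnorm (x - y) = cnorm (y - x).
Proof. by rewrite -cnormN opprB. Qed.

Lemma cnorm_star (A : cstarNormedType R) (x : A) : cnorm (star x) = cnorm x.
Proof.
have h (y : A) : cnorm y <= cnorm (star y).
  have [->|y0] := eqVneq (cnorm y) 0; first exact: cnorm_ge0.
  have yp : 0 < cnorm y by rewrite lt_neqAle eq_sym y0 cnorm_ge0.
  by rewrite -(ler_pM2r yp) -expr2 -cnorm_star_id cnormM.
by apply/eqP; rewrite eq_le h -{2}(starK x) h.
Qed.

Lemma inv_lt (e : R) : 0 < e -> exists N, forall n, (N <= n)%N -> n.+1%:R^-1 < e.
Proof.
move=> e0; exists (Num.truncn e^-1) => n Nn.
rewrite invf_plt ?posrE ?ltr0n // (lt_le_trans (truncnS_gt _)) //.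
by rewrite ler_nat ltnS.
Qed.

Lemma complete_of_seq (A : cstarNormedType R) :
  (forall u : nat -> A, seq_cauchy u -> exists l, seq_limit u l) ->
  forall F : set_system (normed_copy A), ProperFilter F -> cauchy F -> cvg F.
Proof.
move=> ch F PF /cauchyP FC.
have ex n : exists x : A, F [set y : A | cnorm (x - y) < n.+1%:R^-1].
  have [|x Fx] := FC (n.+1%:R^-1)%:C%C; first by rewrite ltcR invr_gt0 ltr0n.
  by exists x; apply: filterS Fx => y /normed_copy_ball.
have {ex} [u Fu] := choice ex.
have uc : seq_cauchy u.
  move=> e e0; have [|N Ne] := inv_lt (e := e / 2); first by rewrite divr_gt0.
  exists N => m n mN nN.
  have [y [/= my ny]] := filter_ex (filterI (Fu m) (Fu n)).
  rewrite -(subrKA y) (splitr e) (le_lt_trans (cnormD _ _)) //.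
  rewrite ltrD // ?(lt_trans my) ?Ne //.
  by rewrite cnorm_distC (lt_trans ny) ?Ne.
have [l ul] := ch u uc.
apply/cvg_ex; exists (l : normed_copy A); apply/cvg_ballP => e /gt0_real[r r0 ->].
have [|N Ne] := inv_lt (e := r / 2); first by rewrite divr_gt0.
have [|M Me] := ul (r / 2); first by rewrite divr_gt0.
apply: filterS (Fu (maxn N M)) => y /= uy; apply/normed_copy_ball.
rewrite -(subrKA (u (maxn N M))) (splitr r) (le_lt_trans (cnormD _ _)) //.
rewrite ltrD ?(lt_trans uy) ?Ne ?leq_maxl //.
by rewrite cnorm_distC Me ?leq_maxr.
Qed.

Lemma seq_of_complete (A : cstarType R) (u : nat -> A) :
  seq_cauchy u -> exists l, seq_limit u l.
Proof.
move=> uc; pose v : nat -> normed_copy A := u.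
have : cvg (v @ \oo).
  apply: (@cstar_complete R A); apply/cauchy_exP => e /gt0_real[r r0 ->].
  have [N Ne] := uc r r0; exists (u N : normed_copy A); exists N => // n Nn.
  by apply/normed_copy_ball/Ne => //; exact: leqnn.
move=> /cvg_ex[l /cvg_ballP vl]; exists (l : A) => e e0.
have /= := vl e%:C%C; rewrite ltcR => /(_ e0) [N _ Nl].
exists N => n Nn; rewrite cnorm_distC; apply/normed_copy_ball/Nl; exact: Nn.
Qed.

End SequentialCompleteness.

(** * The commutant as a C*-algebra *)

Section CommutantCstar.
Variables (R : realType) (H : hilbertType R) (c : adjop H).
Local Notation W := (commutant c).
Implicit Types (S T : W).

Lemma opvalP T : [/\ bounded_op (opval T), opval T * c = c * opval T &
  adj_star (opval T) * c = c * adj_star (opval T)].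
Proof. by apply/asboolP; exact: (valP T). Qed.

Lemma commutant_eq S T : (forall x, opval S x = opval T x) -> S = T.
Proof. by move=> ST; apply: val_inj; exact: adjop_eq. Qed.

Definition op_bounds T : set R :=
  [set M | 0 <= M /\ forall x, hnorm (opval T x) <= M * hnorm x].

Definition opnorm T := inf (op_bounds T).

Lemma op_bounds_has_inf T : has_inf (op_bounds T).
Proof.
split; last by exists 0 => M [].
by have [/bounded_op_ge0[M M0 TM] _ _] := opvalP T; exists M.
Qed.

Lemma opnorm_ge0 T : 0 <= opnorm T.
Proof. by apply: lb_le_inf; [exact: (op_bounds_has_inf T).1|move=> M []]. Qed.

Lemma opnorm_le T M : 0 <= M -> (forall x, hnorm (opval T x) <= M * hnorm x) ->
  opnorm T <= M.
Proof. by move=> M0 TM; apply: ge_inf; [exact: (op_bounds_has_inf T).2|split]. Qed.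

Lemma hnorm_op T x : hnorm (opval T x) <= opnorm T * hnorm x.
Proof.
have [->|x0] := eqVneq x 0; first by rewrite afun0 hnorm0 mulr0.
have xp : 0 < hnorm x.
  by rewrite lt_neqAle hnorm_ge0 andbT eq_sym; apply: contra_neq x0 => /hnorm_eq0.
rewrite -ler_pdivrMr //; apply: lb_le_inf; first exact: (op_bounds_has_inf T).1.
by move=> M [_ TM]; rewrite ler_pdivrMr.
Qed.

Definition opstar T : W := insubd 0 (adj_star (opval T)).

Lemma opstarE T : opval (opstar T) = adj_star (opval T).
Proof.
rewrite /opstar; apply: insubdK; have [/bounded_op_ge0[M M0 TM] h1 h2] := opvalP T.
by apply/asboolP; split; rewrite ?adj_starK //; exists M; exact: bounded_op_star_le.
Qed.

Fact opstarD : {morph opstar : S T / S + T}.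
Proof. by move=> S T; apply: val_inj; rewrite /= !opstarE -adj_starD. Qed.
Fact opstarZ (a : R[i]) T : opstar (a *: T) = a^* *: opstar T.
Proof. by apply: val_inj; rewrite /= !opstarE -adj_starZ. Qed.
Fact opstarM S T : opstar (S * T) = opstar T * opstar S.
Proof. by apply: val_inj; rewrite /= !opstarE -adj_starM. Qed.
Fact opstarK : involutive opstar.
Proof. by move=> T; apply: val_inj; rewrite /= !opstarE adj_starK. Qed.

Fact opnormD S T : opnorm (S + T) <= opnorm S + opnorm T.
Proof.
apply: opnorm_le => [|x]; first by rewrite addr_ge0 ?opnorm_ge0.
by rewrite mulrDl (le_trans (hnorm_triangle _ _)) // lerD // hnorm_op.
Qed.

Lemma opnormZ_le (a : R[i]) T : opnorm (a *: T) <= cabs a * opnorm T.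
Proof.
apply: opnorm_le => [|x]; first by rewrite mulr_ge0 ?opnorm_ge0 ?cabs_ge0.
by rewrite /= hnormZ -mulrA ler_wpM2l ?cabs_ge0 // hnorm_op.
Qed.

Fact opnormZ (a : R[i]) T : (opnorm (a *: T))%:C%C = `|a| * (opnorm T)%:C%C.
Proof.
rewrite -cabsE -rmorphM; congr (_ %:C)%C; apply/eqP; rewrite eq_le opnormZ_le /=.
have [->|a0] := eqVneq a 0.
  by rewrite /cabs /= expr0n /= addr0 sqrtr0 mul0r opnorm_ge0.
have ap : 0 < cabs a.
  by rewrite -ltcR cabsE normr_gt0.
rewrite -ler_pdivlMl //.
have {1}-> : T = a^-1 *: (a *: T) by rewrite scalerA mulVf ?scale1r.
rewrite (le_trans (opnormZ_le _ _)) //.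
suff -> : cabs a^-1 = (cabs a)^-1 by [].
by apply: (@complexI R); rewrite cabsE fmorphV /= cabsE normfV.
Qed.

Fact opnorm0_eq0 T : opnorm T = 0 -> T = 0.
Proof.
move=> T0; apply: commutant_eq => x; apply: hnorm_eq0; apply/eqP.
by rewrite eq_le hnorm_ge0 andbT (le_trans (hnorm_op _ _)) // T0 mul0r.
Qed.

Fact opnormM S T : opnorm (S * T) <= opnorm S * opnorm T.
Proof.
apply: opnorm_le => [|x]; first by rewrite mulr_ge0 ?opnorm_ge0.
by rewrite -mulrA (le_trans (hnorm_op S _)) // ler_wpM2l ?opnorm_ge0 // hnorm_op.
Qed.

Lemma opnorm_star T : opnorm (opstar T) = opnorm T.
Proof.
have h S : opnorm (opstar S) <= opnorm S.
  apply: opnorm_le => [|x]; first exact: opnorm_ge0.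
  rewrite opstarE; apply: bounded_op_star_le; first exact: opnorm_ge0.
  exact: hnorm_op.
by apply/eqP; rewrite eq_le h -{1}(opstarK T) h.
Qed.

Fact opnorm_star_id T : opnorm (opstar T * T) = opnorm T ^+ 2.
Proof.
apply/eqP; rewrite eq_le; apply/andP; split.
  by rewrite (le_trans (opnormM _ _)) // opnorm_star expr2.
rewrite -[leRHS](sqr_sqrtr (opnorm_ge0 _)) ler_pXn2r ?nnegrE ?opnorm_ge0 ?sqrtr_ge0 //.
apply: opnorm_le => [|x]; first exact: sqrtr_ge0.
rewrite -(@ler_pXn2r _ 2) ?nnegrE ?mulr_ge0 ?hnorm_ge0 ?sqrtr_ge0 //.
rewrite hnormE aadjP exprMn sqr_sqrtr ?opnorm_ge0 //.
rewrite (le_trans (hdot_le _ _)) // mulrC expr2 mulrA ler_wpM2r ?hnorm_ge0 //.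
have -> : aadj (opval T) (opval T x) = opval (opstar T * T) x by rewrite /= opstarE.
exact: hnorm_op.
Qed.

HB.instance Definition _ := isCstarNormed.Build R W opstarD opstarZ opstarM
  opstarK opnormD opnormZ opnorm0_eq0 opnormM opnorm_star_id.

End CommutantCstar.

Section CommutantComplete.
Variables (R : realType) (H : hilbertType R) (c : adjop H).
Local Notation W := (commutant c).

(** Limits of operators are handled weakly: an identity between limits is tested
    against [hdot]. *)
Lemma hdot_cvg (u : nat -> H) l y :
  (forall e, 0 < e -> exists N, forall n, (N <= n)%N -> hnorm (u n - l) < e) ->
  hdot (u n) y @[n --> \oo] --> hdot l y.
Proof.
move=> ul; apply/cvgrPdist_lt => e e0.
have yp : 0 < hnorm y + 1 by rewrite ltr_wpDl ?hnorm_ge0.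
have [|N Nu] := ul (e / (hnorm y + 1)); first by rewrite divr_gt0.
exists N => // n /Nu h; rewrite -hdotBl -sqrtr_sqr.
rewrite (le_lt_trans (ler_wsqrtr (hdot_le_sqr _ _))) // -!hnormE -exprMn sqrtr_sqr.
rewrite ger0_norm ?mulr_ge0 ?hnorm_ge0 // -(opprB (u n)) hnormN.
rewrite (@le_lt_trans _ _ (hnorm (u n - l) * (hnorm y + 1))) //.
  by rewrite ler_wpM2l ?hnorm_ge0 // lerDl.
by rewrite -ltr_pdivlMr.
Qed.

(** A Cauchy sequence and the sequence of its adjoints converge pointwise; the
    limits are adjoint to each other, and convergence is uniform on bounded sets
    by letting one index of the Cauchy condition tend to infinity. *)
Lemma commutant_seq_complete (u : nat -> W) :
  seq_cauchy u -> exists l, seq_limit u l.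
Proof.
move=> uc.
have pc (v : nat -> W) : seq_cauchy v -> forall x, exists l, forall e, 0 < e ->
    exists N, forall n, (N <= n)%N -> hnorm (opval (v n) x - l) < e.
  move=> vc x; apply: hnorm_complete => e e0.
  have xp : 0 < hnorm x + 1 by rewrite ltr_wpDl ?hnorm_ge0.
  have [|N Nv] := vc (e / (hnorm x + 1)); first by rewrite divr_gt0.
  exists N => m n Nm Nn.
  have -> : opval (v m) x - opval (v n) x = opval (v m - v n) x by rewrite /= scaleN1r.
  rewrite (le_lt_trans (hnorm_op _ _)) //.
  rewrite (@le_lt_trans _ _ (cnorm (v m - v n) * (hnorm x + 1))) //.
    by rewrite ler_wpM2l ?opnorm_ge0 // lerDl.
  by rewrite -ltr_pdivlMr // Nv.
have [f fl] := choice (pc u uc).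
have usc : seq_cauchy (fun n => opstar (u n)).
  move=> e /uc[N Nu]; exists N => m n Nm Nn.
  have -> : opstar (u m) - opstar (u n) = opstar (u m - u n).
    apply: (addIr (opstar (u n))).
    by rewrite subrK -opstarD subrK.
  by rewrite /cnorm /= opnorm_star Nu.
have [g gl] := choice (pc _ usc).
have fw x y := hdot_cvg (y := y) (fl x); have gw x y := hdot_cvg (y := y) (gl x).
have wlim (a b : H) : (forall y, exists2 s : nat -> R,
    s @ \oo --> hdot a y & s @ \oo --> hdot b y) -> a = b.
  move=> h; apply: hdot_nondeg => y; have [s sa sb] := h y.
  exact: norm_cvg_unique sa sb.
have fZ (d : R[i]) x : f (d *: x) = d *: f x.
  apply: wlim => y; exists (fun n => hdot (opval (u n) (d *: x)) y); first exact: fw.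
  by under eq_fun do rewrite afunZ hdotZ; rewrite hdotZ; exact: fw.
have fg x y : hdot (f x) y = hdot x (g y).
  rewrite (hdotC x); apply: (norm_cvg_unique (fw x y)).
  rewrite /= [X in X @ _ --> _](_ : _ = fun n => hdot (opval (opstar (u n)) y) x).
    exact: gw.
  by apply/funext => n; rewrite opstarE aadjP' hdotC.
pose F := AdjOp fZ fg.
have close e : 0 < e -> exists N, forall n, (N <= n)%N -> forall x,
    hnorm (opval (u n) x - f x) <= e * hnorm x.
  move=> /uc[N Nu]; exists N => n Nn x; apply/ler_addgt0Pr => d d0.
  have [M Mu] := fl x d d0.
  rewrite -(subrKA (opval (u (maxn N M)) x)) (le_trans (hnorm_triangle _ _)) //.
  rewrite lerD ?(ltW (Mu _ _)) ?leq_maxr //.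
  have -> : opval (u n) x - opval (u (maxn N M)) x = opval (u n - u (maxn N M)) x.
    by rewrite /= scaleN1r.
  rewrite (le_trans (hnorm_op _ _)) // ler_wpM2r ?hnorm_ge0 //.
  by apply/ltW/Nu => //; exact: leq_maxl.
have FW : in_commutant c F.
  apply/asboolP; split.
  - have [N Nu] := close 1 ltr01; exists (opnorm (u N) + 1) => x.
    rewrite -[F x](subKr (opval (u N) x)) (le_trans (hnorm_triangle _ _)) //.
    by rewrite hnormN mulrDl lerD ?hnorm_op // Nu.
  - apply: adjop_eq => x; apply: wlim => y.
    exists (fun n => hdot (opval (u n) (c x)) y); first exact: fw.
    have uC n : opval (u n) (c x) = c (opval (u n) x).
      by have [_ h _] := opvalP (u n); exact: (congr1 (fun T : adjop H => T x) h).
    by under eq_fun do rewrite uC aadjP; rewrite -[(c * F) x]/(c (f x)) aadjP; exact: fw.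
  - apply: adjop_eq => x; apply: wlim => y.
    exists (fun n => hdot (opval (opstar (u n)) (c x)) y); first exact: gw.
    have uC n : opval (opstar (u n)) (c x) = c (opval (opstar (u n)) x).
      have [_ h _] := opvalP (opstar (u n)).
      exact: (congr1 (fun T : adjop H => T x) h).
    by under eq_fun do rewrite uC aadjP; rewrite -[(c * _) x]/(c (g x)) aadjP; exact: gw.
exists (Commutant FW) => e e0.
have [|N Nu] := close (e / 2); first by rewrite divr_gt0.
exists N => n Nn; rewrite (@le_lt_trans _ _ (e / 2)) //; last first.
  by rewrite ltr_pdivrMr // mulr_natr mulr2n ltrDl.
apply: opnorm_le => [|x]; first by rewrite divr_ge0 // ltW.
by rewrite /= scaleN1r Nu.
Qed.

HB.instance Definition _ :=
  isCstarComplete.Build R W (complete_of_seq commutant_seq_complete).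

End CommutantComplete.

(** * Products of C*-algebras *)

Section ProductCstar.
Variables (R : realType) (A B : cstarType R).
Local Notation W := (A * B)%type.
Implicit Types (x y : W).

Definition pstar x : W := (star x.1, star x.2).
Definition pnorm x : R := Num.max (cnorm x.1) (cnorm x.2).

Fact pstarD : {morph pstar : x y / x + y}.
Proof. by move=> x y; rewrite /pstar /= !starD. Qed.
Fact pstarZ (c : R[i]) x : pstar (c *: x) = c^* *: pstar x.
Proof. by rewrite /pstar /= !starZ. Qed.
Fact pstarM x y : pstar (x * y) = pstar y * pstar x.
Proof. by rewrite /pstar /= !starM. Qed.
Fact pstarK : involutive pstar.
Proof. by case=> a b; rewrite /pstar /= !starK. Qed.

Lemma pnorm1 x : cnorm x.1 <= pnorm x. Proof. by rewrite le_max lexx. Qed.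
Lemma pnorm2 x : cnorm x.2 <= pnorm x. Proof. by rewrite le_max lexx orbT. Qed.

Fact pnormD x y : pnorm (x + y) <= pnorm x + pnorm y.
Proof.
by rewrite ge_max !(le_trans (cnormD _ _)) // lerD // ?pnorm1 ?pnorm2.
Qed.

Lemma cnormZr (D : cstarNormedType R) (c : R[i]) (x : D) :
  cnorm (c *: x) = cabs c * cnorm x.
Proof. by apply: (@complexI R); rewrite cnormZ -cabsE rmorphM. Qed.

Fact pnormZ (c : R[i]) x : (pnorm (c *: x))%:C%C = `|c| * (pnorm x)%:C%C.
Proof.
rewrite -cabsE -rmorphM; congr (_ %:C)%C.
by rewrite /pnorm /= !cnormZr maxr_pMr // cabs_ge0.
Qed.

Fact pnorm0_eq0 x : pnorm x = 0 -> x = 0.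
Proof.
move=> x0; have h1 := pnorm1 x; have h2 := pnorm2 x; move: h1 h2; rewrite x0 => h1 h2.
rewrite [x]surjective_pairing [LHS](_ : _ = (0, 0)) //; congr (_, _);
  apply: cnorm0_eq0; apply/eqP; rewrite eq_le cnorm_ge0 andbT //.
Qed.

Fact pnormM x y : pnorm (x * y) <= pnorm x * pnorm y.
Proof.
by rewrite ge_max !(le_trans (cnormM _ _)) // ler_pM ?cnorm_ge0 ?pnorm1 ?pnorm2.
Qed.

Fact pnorm_star_id x : pnorm (pstar x * x) = pnorm x ^+ 2.
Proof.
rewrite /pnorm /= !cnorm_star_id; have := cnorm_ge0 x.1; have := cnorm_ge0 x.2.
move=> h2 h1; case: (leP (cnorm x.1) (cnorm x.2)) => h.
  by rewrite max_r // ler_pXn2r ?nnegrE.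
by rewrite max_l // ler_pXn2r ?nnegrE // ltW.
Qed.

HB.instance Definition _ := isCstarNormed.Build R W pstarD pstarZ pstarM pstarK
  pnormD pnormZ pnorm0_eq0 pnormM pnorm_star_id.

Lemma product_seq_complete (u : nat -> W) :
  seq_cauchy u -> exists l, seq_limit u l.
Proof.
move=> uc.
have [|l1 ul1] := @seq_of_complete R A (fun n => (u n).1).
  move=> e /uc[N Nu]; exists N => m n Nm Nn.
  by rewrite (le_lt_trans (pnorm1 (u m - u n))) // Nu.
have [|l2 ul2] := @seq_of_complete R B (fun n => (u n).2).
  move=> e /uc[N Nu]; exists N => m n Nm Nn.
  by rewrite (le_lt_trans (pnorm2 (u m - u n))) // Nu.
exists (l1, l2) => e e0; have [N1 h1] := ul1 e e0; have [N2 h2] := ul2 e e0.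
exists (maxn N1 N2) => n; rewrite geq_max => /andP[n1 n2].
by rewrite /cnorm /= gt_max h1 // h2.
Qed.

HB.instance Definition _ :=
  isCstarComplete.Build R W (complete_of_seq product_seq_complete).

End ProductCstar.

(** * Unconditional sums *)

Section UnconditionalSums.
Variables (R : realType) (S : choiceType).
Implicit Types (g h : S -> R) (F G : {fset S}).

(** The filter of sections of the directed set of finite subsets. *)
Definition totally : set_system {fset S} :=
  filter_from setT (fun F => [set G | (F `<=` G)%fset]).

#[global] Instance totally_filter : ProperFilter totally.
Proof.
apply: filter_from_proper; last by move=> F _; exists F => /=.
apply: filter_fromT_filter; first by exists fset0.
move=> F G; exists (F `|` G)%fset => E /= /fsubUsetP[FE GE] //.
Qed.

Definition fsum g F := \sum_(s <- F) g s.

Definition has_sum g (l : R) := fsum g @ totally --> l.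

Lemma fsum_mono g F G : (forall s, 0 <= g s) -> (F `<=` G)%fset ->
  fsum g F <= fsum g G.
Proof.
move=> g0 FG; rewrite /fsum [leRHS](big_fsetID _ (mem F)) /=.
rewrite [X in X + _](_ : _ = \sum_(s <- F) g s); last first.
  apply: eq_fbigl => s; rewrite !inE /=.
  by case sF: (s \in F); rewrite ?andbF //= andbT (fsubsetP FG).
by rewrite lerDl sumr_ge0.
Qed.

Lemma fsumD g h F : fsum (fun s => g s + h s) F = fsum g F + fsum h F.
Proof. exact: big_split. Qed.

Lemma fsumZ (r : R) g F : fsum (fun s => r * g s) F = r * fsum g F.
Proof. by rewrite /fsum mulr_sumr. Qed.

Lemma has_sumD g h a b : has_sum g a -> has_sum h b ->
  has_sum (fun s => g s + h s) (a + b).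
Proof.
move=> ga hb; rewrite /has_sum.
have -> : fsum (fun s => g s + h s) = fsum g + fsum h.
  by apply/funext => F; exact: fsumD.
exact: cvgD.
Qed.

Lemma has_sumZ r g a : has_sum g a -> has_sum (fun s => r * g s) (r * a).
Proof.
move=> ga; rewrite /has_sum.
have -> : fsum (fun s => r * g s) = (fun F => r * fsum g F).
  by apply/funext => F; exact: fsumZ.
by apply: cvgM => //; exact: cvg_cst.
Qed.

Lemma has_sum_unique g a b : has_sum g a -> has_sum g b -> a = b.
Proof. exact: norm_cvg_unique. Qed.

Lemma has_sum_le g M a : has_sum g a -> (forall F, fsum g F <= M) -> a <= M.
Proof. by move=> ga gM; apply: (cvgr_to_le ga); exact: nearW. Qed.

Lemma has_sum_ge g a F : (forall s, 0 <= g s) -> has_sum g a -> fsum g F <= a.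
Proof.
move=> g0 ga; apply: (cvgr_to_ge ga); exists F => // G FG.
exact: fsum_mono.
Qed.

Lemma has_sum_bounded g M : (forall s, 0 <= g s) -> (forall F, fsum g F <= M) ->
  exists a, has_sum g a.
Proof.
move=> g0 gM; exists (sup (range (fsum g))).
have hs : has_sup (range (fsum g)).
  by split; [exists (fsum g fset0), fset0|exists M => _ [F _ <-]].
apply/cvgrPdist_lt => e e0.
have [_ [F _ <-] Fe] := sup_adherent e0 hs.
exists F => // G FG; rewrite ger0_norm ?subr_ge0; last first.
  by apply: ub_le_sup; [exact: hs.2|exists G].
by rewrite ltrBlDr -ltrBlDl (lt_le_trans Fe) // fsum_mono.
Qed.

Section PartialInjection.
Variables (t t' : S -> option S).
Hypothesis tP : forall x y, t x = Some y <-> t' y = Some x.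

Lemma sum_pull (g : S -> S -> R) (F : seq S) :
  \sum_(x <- F) oapp (g x) 0 (t x) = \sum_(y <- pmap t F) oapp (g^~ y) 0 (t' y).
Proof.
elim: F => [|x F IH] /=; first by rewrite !big_nil.
rewrite big_cons IH; case E: (t x) => [y|] /=; last by rewrite add0r.
by rewrite big_cons; move/tP: E => ->.
Qed.

Lemma pmap_pinj_uniq (F : seq S) : uniq F -> uniq (pmap t F).
Proof.
elim: F => //= x F IH /andP[xF uF]; case E: (t x) => [y|] /=; last exact: IH.
rewrite IH // andbT mem_pmap; apply: contra xF => /mapP[z zF /esym/tP zy].
by move/tP: E; rewrite zy => -[<-].
Qed.

(** Both sums run over the pairs x, y with t x = Some y, since the terms outside
    the domains of t and t' vanish. *)
Lemma has_sum_pull (g : S -> S -> R) a :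
  has_sum (fun x => oapp (g x) 0 (t x)) a ->
  has_sum (fun y => oapp (g^~ y) 0 (t' y)) a.
Proof.
move=> ga U /ga[F0 _ FU].
exists [fset y in pmap t F0]%fset => // G /= /fsubsetP GF.
pose F := (F0 `|` [fset x in pmap t' G])%fset.
suff <- : fsum (fun x => oapp (g x) 0 (t x)) F =
          fsum (fun y => oapp (g^~ y) 0 (t' y)) G.
  by apply: FU; exact: fsubsetUl.
rewrite /fsum sum_pull.
have -> : \sum_(y <- pmap t F) oapp (g^~ y) 0 (t' y) =
    \sum_(y <- [fset y in pmap t F]%fset) oapp (g^~ y) 0 (t' y).
  by apply: perm_big; rewrite perm_sym uniq_perm ?fset_uniq ?pmap_pinj_uniq ?fset_uniq // => y; rewrite !inE.
apply: big_fset_incl => [|y yG].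
  apply/fsubsetP => y; rewrite !inE mem_pmap => /mapP[x xF xy].
  move: xF; rewrite !inE => /orP[xF|].
    by apply: GF; rewrite !inE mem_pmap; apply/mapP; exists x.
  rewrite mem_pmap => /mapP[z zG /esym/tP xz].
  by move: xz; rewrite -xy => -[->].
rewrite !inE mem_pmap => /mapP h; case E: (t' y) => [x|] //=; case: h.
exists x; last by apply/esym/tP.
by rewrite !inE mem_pmap; apply/orP; right; apply/mapP; exists y.
Qed.

End PartialInjection.
End UnconditionalSums.
Arguments totally {S}.

(** * The Hilbert space l2 *)

Section SquareSummable.
Variables (R : realType) (S : choiceType).

Definition cdot (a b : R[i]) : R :=
  complex.Re a * complex.Re b + complex.Im a * complex.Im b.

Lemma cdotC a b : cdot a b = cdot b a.
Proof. by rewrite /cdot mulrC [X in _ + X]mulrC. Qed.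

Lemma cdotDl a b c : cdot (a + b) c = cdot a c + cdot b c.
Proof. by case: a b c => [? ?] [? ?] [? ?]; rewrite /cdot /=; ring. Qed.

Lemma cdotZ (c a b : R[i]) : cdot (c * a) b = cdot a (c^* * b).
Proof. by case: a b c => [? ?] [? ?] [? ?]; rewrite /cdot /=; ring. Qed.

Lemma cdotZr (r : R) a b : cdot (r%:C%C * a) b = r * cdot a b.
Proof. by case: a b => [? ?] [? ?]; rewrite /cdot /=; ring. Qed.

Lemma cdot_ge0 a : 0 <= cdot a a.
Proof. by rewrite addr_ge0 // -expr2 sqr_ge0. Qed.

Lemma cdot_eq0 a : cdot a a = 0 -> a = 0.
Proof.
move=> /eqP; rewrite /cdot -!expr2 paddr_eq0 ?sqr_ge0 // !sqrf_eq0.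
by case: a => x y /= /andP[/eqP -> /eqP ->].
Qed.

Lemma cdotDD_le a b : cdot (a + b) (a + b) <= 2 * cdot a a + 2 * cdot b b.
Proof.
have := cdot_ge0 (a - b); case: a b => [? ?] [? ?]; rewrite /cdot /=.
by move=> h; lra.
Qed.

Lemma cdot_mul (c a : R[i]) : cdot (c * a) (c * a) = cdot c c * cdot a a.
Proof. by case: a c => [? ?] [? ?]; rewrite /cdot /=; ring. Qed.

(** Reduces the convergence of inner products to that of sums of squares. *)
Lemma cdot_polar a b :
  cdot a b = 2^-1 * cdot (a + b) (a + b) +
             (- 2^-1 * cdot a a + - 2^-1 * cdot b b).
Proof. by case: a b => [? ?] [? ?]; rewrite /cdot /=; field. Qed.

Definition is_l2 (x : S -> R[i]) : bool :=
  `[< exists M, forall F, fsum (fun s => cdot (x s) (x s)) F <= M >].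

Fact is_l2_closed : submod_closed is_l2.
Proof.
split=> [|a x y /asboolP[M xM] /asboolP[N yN]]; apply/asboolP.
  by exists 0 => F; rewrite /fsum big1 // => s _; rewrite /cdot /= !mul0r addr0.
exists (2 * cdot a a * M + 2 * N) => F.
rewrite (@le_trans _ _ (2 * cdot a a * fsum (fun s => cdot (x s) (x s)) F +
    2 * fsum (fun s => cdot (y s) (y s)) F)) //.
  rewrite -!fsumZ -fsumD; apply: ler_sum => s _.
  by rewrite (le_trans (cdotDD_le _ _)) // cdot_mul mulrA.
by rewrite lerD // ler_wpM2l // mulr_ge0 // cdot_ge0.
Qed.

HB.instance Definition _ := GRing.isSubmodClosed.Build R[i] (S -> R[i]) is_l2
  (GRing.submod_closed_semi is_l2_closed).

Record l2 := L2 { l2v :> S -> R[i]; _ : is_l2 l2v }.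

HB.instance Definition _ := [isSub for l2v].
HB.instance Definition _ := [Choice of l2 by <:].
HB.instance Definition _ := [SubChoice_isSubLmodule of l2 by <:].

Implicit Types x y : l2.

Lemma l2_eq x y : (forall s, x s = y s) -> x = y.
Proof. by move=> xy; apply: val_inj; exact/funext. Qed.

Lemma l2_sq x : exists a, has_sum (fun s => cdot (x s) (x s)) a.
Proof.
have /asboolP[M xM] := valP x; apply: (has_sum_bounded _ xM) => s.
exact: cdot_ge0.
Qed.

Definition l2dot x y := lim (fsum (fun s => cdot (x s) (y s)) @ totally).

Lemma l2dotP x y : has_sum (fun s => cdot (x s) (y s)) (l2dot x y).
Proof.
have [a ha] := l2_sq (x + y); have [b hb] := l2_sq x; have [c hc] := l2_sq y.
apply: (@cvgP _ (fsum _ @ totally) (2^-1 * a + (- 2^-1 * b + - 2^-1 * c))).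
rewrite (_ : (fun s => cdot (x s) (y s)) =
    fun s => 2^-1 * cdot ((x + y) s) ((x + y) s) +
       (- 2^-1 * cdot (x s) (x s) + - 2^-1 * cdot (y s) (y s))).
  by apply: has_sumD; [|apply: has_sumD]; exact: has_sumZ.
by apply/funext => s; rewrite cdot_polar.
Qed.

Lemma l2dotE x y a : has_sum (fun s => cdot (x s) (y s)) a -> l2dot x y = a.
Proof. by move=> h; exact: (has_sum_unique (@l2dotP x y) h). Qed.

Fact l2dotC x y : l2dot x y = l2dot y x.
Proof.
apply: l2dotE; rewrite (_ : (fun s => _) = fun s => cdot (y s) (x s)).
  exact: l2dotP.
by apply/funext => s; rewrite cdotC.
Qed.

Fact l2dotDl x y z : l2dot (x + y) z = l2dot x z + l2dot y z.
Proof.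
apply: l2dotE; rewrite (_ : (fun s => _) =
   fun s => cdot (x s) (z s) + cdot (y s) (z s)).
  by apply: has_sumD; exact: l2dotP.
by apply/funext => s; rewrite -cdotDl.
Qed.

Fact l2dotZ (c : R[i]) x y : l2dot (c *: x) y = l2dot x (c^* *: y).
Proof.
apply: l2dotE; rewrite (_ : (fun s => _) = fun s => cdot (x s) ((c^* *: y) s)).
  exact: l2dotP.
by apply/funext => s; rewrite -cdotZ.
Qed.

Fact l2dotZr (r : R) x y : l2dot (r%:C%C *: x) y = r * l2dot x y.
Proof.
apply: l2dotE; rewrite (_ : (fun s => _) = fun s => r * cdot (x s) (y s)).
  by apply: has_sumZ; exact: l2dotP.
by apply/funext => s; rewrite -cdotZr.
Qed.

Lemma l2dot_coord x s : cdot (x s) (x s) <= l2dot x x.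
Proof.
have := @has_sum_ge _ _ _ _ [fset s]%fset (fun s => cdot_ge0 (x s)) (@l2dotP x x).
by rewrite /fsum big_seq_fset1.
Qed.

Fact l2dot_ge0 x : 0 <= l2dot x x.
Proof.
have := @has_sum_ge _ _ _ _ fset0 (fun s => cdot_ge0 (x s)) (@l2dotP x x).
by rewrite /fsum big_seq_fset0.
Qed.

Fact l2dot_eq0 x : l2dot x x = 0 -> x = 0.
Proof.
move=> x0; apply: l2_eq => s; apply: cdot_eq0; apply/eqP.
by rewrite eq_le cdot_ge0 andbT -x0 l2dot_coord.
Qed.

Definition basis_fun (s t : S) : R[i] := (t == s)%:R.

Lemma has_sum_point (s : S) (g : S -> R) :
  (forall t, t != s -> g t = 0) -> has_sum g (g s).
Proof.
move=> g0 U Us; exists [fset s]%fset => // F /= sF.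
rewrite /fsum (big_fsetD1 s) ?(fsubsetP sF) ?inE //= big1_seq ?addr0.
  exact: nbhs_singleton.
by move=> t /andP[_]; rewrite !inE => /andP[ts _]; exact: g0.
Qed.

Fact basis_fun_l2 s : is_l2 (basis_fun s).
Proof.
apply/asboolP; exists (cdot (basis_fun s s) (basis_fun s s)) => F.
apply: has_sum_ge => [t|]; first exact: cdot_ge0.
apply: (@has_sum_point s (fun t => cdot (basis_fun s t) (basis_fun s t))) => t /negPf ts.
by rewrite /basis_fun ts /cdot /= !mul0r addr0.
Qed.

Definition basis_vec s := L2 (basis_fun_l2 s).

End SquareSummable.

(** Index types are pointed so that l2 is not zero. *)
HB.instance Definition _ := isPointed.Build int 0.

Section SquareSummableHilbert.
Variables (R : realType) (S : pointedType).

Fact l2_nontrivial : exists x : l2 R S, x != 0.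
Proof.
exists (basis_vec R point); apply/eqP => /(congr1 (fun x : l2 R S => x point)).
by rewrite /= /basis_fun eqxx => /eqP; rewrite oner_eq0.
Qed.

Lemma real_seq_complete (a : nat -> R) :
  (forall e, 0 < e -> exists N, forall m n, (N <= m)%N -> (N <= n)%N ->
     (a m - a n) ^+ 2 < e) -> exists l : R, a @ \oo --> l.
Proof.
move=> ac; apply/cvg_ex/cauchy_cvgP/cauchy_exP => e e0.
have [|N Na] := ac (e ^+ 2); first by rewrite exprn_gt0.
exists (a N), N => // n /= Nn; rewrite /ball /=.
have := Na N n (leqnn N) Nn; rewrite -[(a N - a n) ^+ 2]real_normK ?num_real //.
by rewrite ltr_pXn2r ?nnegrE ?(ltW e0).
Qed.

(** The limit is taken coordinatewise; membership in l2 and convergence follow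
    from a bound on finite sums that passes to the limit. *)
Fact l2_complete (u : nat -> l2 R S) :
  (forall e, 0 < e -> exists N, forall m n, (N <= m)%N -> (N <= n)%N ->
     l2dot (u m - u n) (u m - u n) < e) ->
  exists l, forall e, 0 < e -> exists N, forall n, (N <= n)%N ->
    l2dot (u n - l) (u n - l) < e.
Proof.
move=> uc.
have coord s : exists z : R[i],
    complex.Re (u n s) @[n --> \oo] --> complex.Re z /\
    complex.Im (u n s) @[n --> \oo] --> complex.Im z.
  have h e : 0 < e -> exists N, forall m n, (N <= m)%N -> (N <= n)%N ->
      (complex.Re (u m s) - complex.Re (u n s)) ^+ 2 +
      (complex.Im (u m s) - complex.Im (u n s)) ^+ 2 < e.
    move=> /uc[N Nu]; exists N => m n Nm Nn.
    apply: le_lt_trans (Nu m n Nm Nn); apply: le_trans (l2dot_coord _ s).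
    rewrite [(u m - u n) s](_ : _ = u m s - u n s) //; move: (u m s) (u n s).
    by case=> [? ?] [? ?]; rewrite /cdot /= !expr2.
  have [|a ua] := @real_seq_complete (fun n => complex.Re (u n s)).
    move=> e /h[N Ne]; exists N => m n Nm Nn; apply: le_lt_trans (Ne m n Nm Nn).
    by rewrite lerDl sqr_ge0.
  have [|b ub] := @real_seq_complete (fun n => complex.Im (u n s)).
    move=> e /h[N Ne]; exists N => m n Nm Nn; apply: le_lt_trans (Ne m n Nm Nn).
    by rewrite lerDr sqr_ge0.
  by exists (a +i* b)%C.
have [x ux] := choice coord.
have dist_cvg (v : S -> R[i]) F :
    fsum (fun s => cdot (v s - u m s) (v s - u m s)) F @[m --> \oo] -->
    fsum (fun s => cdot (v s - x s) (v s - x s)) F.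
  rewrite /fsum; elim: (enum_fset F) => [|s E IH].
    by under eq_fun do rewrite big_nil; rewrite big_nil; exact: cvg_cst.
  under eq_fun do rewrite big_cons; rewrite big_cons; apply: cvgD IH.
  have [ur ui] := ux s.
  have hr : complex.Re (v s - u m s) @[m --> \oo] --> complex.Re (v s - x s).
    rewrite !raddfB; under eq_fun do rewrite raddfB.
    by apply: cvgB => //; exact: cvg_cst.
  have hi : complex.Im (v s - u m s) @[m --> \oo] --> complex.Im (v s - x s).
    rewrite !raddfB; under eq_fun do rewrite raddfB.
    by apply: cvgB => //; exact: cvg_cst.
  by apply: cvgD; apply: cvgM.
have close e : 0 < e -> exists N, forall n, (N <= n)%N -> forall F,
    fsum (fun s => cdot (u n s - x s) (u n s - x s)) F <= e.
  move=> /uc[N Nu]; exists N => n Nn F; apply: (cvgr_to_le (dist_cvg (u n) F)).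
  exists N => // m Nm; apply: le_trans (ltW (Nu n m Nn Nm)).
  exact: (@has_sum_ge _ _ _ _ F (fun s => cdot_ge0 ((u n - u m) s)) (@l2dotP _ _ _ _)).
have [N0 xN0] := close 1 ltr01.
have dl : is_l2 (fun s => u N0 s - x s) by apply/asboolP; exists 1; exact: xN0.
pose l := u N0 - L2 dl.
have lE s : l s = x s.
  by rewrite [LHS](_ : _ = u N0 s - (u N0 s - x s)) // subKr.
exists l => e e0; have [|N Nx] := close (e / 2); first by rewrite divr_gt0.
exists N => n Nn; rewrite (@le_lt_trans _ _ (e / 2)) //; last first.
  by rewrite ltr_pdivrMr // mulr_natr mulr2n ltrDl.
apply: (has_sum_le (@l2dotP _ _ (u n - l) (u n - l))) => F.
apply: le_trans (Nx n Nn F); rewrite le_eqVlt; apply/orP; left; apply/eqP.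
by apply: eq_bigr => s _; rewrite -lE.
Qed.

HB.instance Definition _ := isHilbert.Build R (l2 R S) (@l2dotC R S)
  (@l2dotDl R S) (@l2dotZ R S) (@l2dotZr R S) (@l2dot_ge0 R S) (@l2dot_eq0 R S)
  l2_nontrivial l2_complete.

End SquareSummableHilbert.

(** * Operators of partial injections *)

Section PartialInjectionOperators.
Variables (R : realType) (S : pointedType).

Record pinj := Pinj {
  pinj_fun : S -> option S;
  pinj_inv : S -> option S;
  pinjP : forall x y, pinj_fun x = Some y <-> pinj_inv y = Some x
}.

Definition pinj_sym (p : pinj) : pinj := Pinj (fun x y => iff_sym (pinjP p y x)).

(** The operator of p sends the basis vector at [pinj_fun p s] to the one at s,
    and kills the basis vectors outside the range of [pinj_fun p]. *)
Definition pull (p : pinj) (x : S -> R[i]) (s : S) : R[i] := oapp x 0 (pinj_fun p s).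

Lemma cdot_pull (p : pinj) (x : S -> R[i]) (y : R[i]) s :
  cdot (pull p x s) y = oapp (fun t => cdot (x t) y) 0 (pinj_fun p s).
Proof. by rewrite /pull; case: (pinj_fun p s) => //=; rewrite /cdot /= !mul0r addr0. Qed.

Lemma pull_fsum (p : pinj) (x : S -> R[i]) F : exists G,
  fsum (fun s => cdot (pull p x s) (pull p x s)) F <=
  fsum (fun s => cdot (x s) (x s)) G.
Proof.
exists [fset s in pmap (pinj_fun p) F]%fset; rewrite /fsum.
have -> : \sum_(s <- F) cdot (pull p x s) (pull p x s) =
    \sum_(s <- F) oapp (fun t => cdot (x t) (x t)) 0 (pinj_fun p s).
  apply: eq_bigr => s _; rewrite cdot_pull /pull; by case: (pinj_fun p s).
rewrite (sum_pull (@pinjP p) (fun _ t => cdot (x t) (x t))).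
have -> : \sum_(s <- [fset s in pmap (pinj_fun p) F]%fset) cdot (x s) (x s) =
    \sum_(s <- pmap (pinj_fun p) F) cdot (x s) (x s).
  apply: perm_big; rewrite uniq_perm ?fset_uniq ?(pmap_pinj_uniq (@pinjP p)) //.
  by move=> y; rewrite !inE.
by apply: ler_sum => t _; case: (pinj_inv p t) => //=; exact: cdot_ge0.
Qed.

Fact pull_l2 p (x : l2 R S) : is_l2 (pull p x).
Proof.
apply/asboolP; have /asboolP[M xM] := valP x; exists M => F.
by have [G h] := pull_fsum p x F; apply: le_trans h (xM G).
Qed.

Definition pull_vec p (x : l2 R S) := L2 (pull_l2 p x).

Fact pull_vecZ p (c : R[i]) x : pull_vec p (c *: x) = c *: pull_vec p x.
Proof.
apply: l2_eq => s; rewrite [RHS](_ : _ = c * pull p x s) //= /pull.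
by case: (pinj_fun p s) => //=; rewrite mulr0.
Qed.

Fact pull_vec_adj p x y : hdot (pull_vec p x) y = hdot x (pull_vec (pinj_sym p) y).
Proof.
apply: l2dotE.
rewrite (_ : (fun s => _) = fun s => oapp (fun t => cdot (x t) (y s)) 0 (pinj_fun p s)).
  apply: (@has_sum_pull _ _ (pinj_inv p) (pinj_fun p) (pinjP (pinj_sym p))
    (fun t s => cdot (x t) (y s))).
  have := @l2dotP R S x (pull_vec (pinj_sym p) y).
  rewrite (_ : (fun s => _) = fun t => oapp (fun s => cdot (x t) (y s)) 0 (pinj_inv p t)) //.
  apply/funext => t; rewrite cdotC cdot_pull /=; case: (pinj_inv p t) => //= s.
  by rewrite cdotC.
by apply/funext => s; rewrite cdot_pull.
Qed.

Definition pinj_adjop p := AdjOp (pull_vecZ p) (pull_vec_adj p).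

Fact pinj_op_in_commutant p : in_commutant 1 (pinj_adjop p).
Proof.
apply/asboolP; rewrite !mul1r !mulr1; split=> //; exists 1 => x; rewrite mul1r.
apply: ler_wsqrtr; apply: (has_sum_le (@l2dotP _ _ (pull_vec p x) (pull_vec p x))) => F.
have [G h] := pull_fsum p x F; apply: le_trans h _.
exact: (@has_sum_ge _ _ _ _ G (fun s => cdot_ge0 (x s)) (@l2dotP _ _ x x)).
Qed.

Definition pinj_op p := Commutant (pinj_op_in_commutant p).

Lemma pinj_op_star p : star (pinj_op p) = pinj_op (pinj_sym p).
Proof. by apply: commutant_eq => x; rewrite /star /= opstarE. Qed.

Lemma commutant_l2_eq (A B : commutant (1 : adjop (l2 R S))) :
  (forall (x : l2 R S) s, opval A x s = opval B x s) -> A = B.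
Proof. by move=> AB; apply: commutant_eq => x; exact: l2_eq. Qed.

End PartialInjectionOperators.

(** * The quotient SU_0(2) *)

Section SU0.
Variables (R : realType) (D : cstarType R).
Implicit Types (a b : D).

Lemma star1 : star (1 : D) = 1.
Proof. by rewrite -[star 1]mul1r -{1}[1](starK (1 : D)) -starM mul1r starK. Qed.

Lemma star0 : star (0 : D) = 0.
Proof. by apply: (addrI (star 0)); rewrite -starD !addr0. Qed.

Definition su0_mx a b : 'M[D]_3 := \matrix_(i, j) nth 0 (nth [::]
  [:: [:: a; b; 0]; [:: star b; star a; 0]; [:: 0; 0; 1]] i) j.

Lemma su0_relations a b : a * star a = 1 -> star a * a + b * star b = 1 ->
  star b * b = b * star b -> a * b = 0 -> a * star b = 0 ->
  A20_relations (su0_mx a b).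
Proof.
move=> aa ab bb ab0 ab'0.
have ba0 : b * star a = 0 by rewrite -[b]starK -starM ab'0 star0.
have b'a0 : star b * star a = 0 by rewrite -starM ab0 star0.
have e : a * star a - star a * a = b * star b by rewrite aa -ab addrC addKr.
pose su := (aa, bb, e, ba0, ab0, ab'0, b'a0, mul0r, mulr0, mul1r, mulr1, starK,
  star0, star1, subr0, subrr).
split; rewrite /su0_mx.
- by do 3 case=> [[|[|[|//]]] ?] /=; rewrite ?mxE //= ?su.
- by do 3 case=> [[|[|[|//]]] ?] /=; rewrite ?mxE //= ?su.
- by do 4 case=> [[|[|[|//]]] ?] /=; rewrite ?mxE //= ?su.
- by do 4 case=> [[|[|[|//]]] ?] /=; rewrite ?mxE //= ?su.
- by do 4 case=> [[|[|[|//]]] ?] /=; rewrite ?mxE //= ?su.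
- by do 4 case=> [[|[|[|//]]] ?] /=; rewrite ?mxE //= ?su.
all: try by rewrite !mxE /= ?su.
by do 4 case=> [[|[|[|//]]] ?] /=; rewrite ?mxE //= ?su.
Qed.

End SU0.

(** * The universal property of the tensor product *)

Section LinearSpan.
Variables (K : pzRingType) (V : lmodType K) (S : set V).

Lemma lspan_cons c s x : S s -> lspan S x -> lspan S (c *: s + x).
Proof.
move=> Ss [n [d [t [St ->]]]].
exists n.+1, (fun k => if unlift ord0 k is Some k' then d k' else c),
  (fun k => if unlift ord0 k is Some k' then t k' else s).
split; first by move=> k; case: unliftP.
rewrite big_ord_recl unlift_none; congr (_ + _).
by apply: eq_bigr => k _; rewrite liftK.
Qed.

Lemma lspan0 : lspan S 0.
Proof. by exists 0, (fun=> 0), (fun=> 0); split=> [[]//|]; rewrite big_ord0. Qed.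

Lemma lspan_ind (P : V -> Prop) : P 0 ->
  (forall c s x, S s -> P x -> P (c *: s + x)) -> forall x, lspan S x -> P x.
Proof.
move=> P0 Pc x [n [c [s [Ss ->]]]].
elim: n c s Ss => [|n IH] c s Ss; first by rewrite big_ord0.
by rewrite big_ord_recl; apply: Pc => //; exact: IH.
Qed.

Lemma lspan_lin a x y : lspan S x -> lspan S y -> lspan S (a *: x + y).
Proof.
move=> xS yS; move: x xS; apply: lspan_ind => [|c s x Ss].
  by rewrite scaler0 add0r.
by rewrite scalerDr scalerA -addrA; exact: lspan_cons.
Qed.

Lemma lspan_gen s : S s -> lspan S s.
Proof. by move=> Ss; rewrite -[s]addr0 -[s]scale1r; apply: lspan_cons lspan0. Qed.

End LinearSpan.

Section StarHom.
Variables (R : realType) (A B : cstarType R) (f : A -> B).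
Hypothesis fP : star_hom f.

Lemma star_homP c x y : f (c *: x + y) = c *: f x + f y.
Proof. by case: fP => fl _ _; exact: fl. Qed.
Lemma star_homD x y : f (x + y) = f x + f y.
Proof. by rewrite -[x]scale1r star_homP !scale1r. Qed.
Lemma star_hom0 : f 0 = 0.
Proof. by apply: (addrI (f 0)); rewrite -star_homD !addr0. Qed.
Lemma star_homZ c x : f (c *: x) = c *: f x.
Proof. by rewrite -[c *: x]addr0 star_homP star_hom0 !addr0. Qed.
Lemma star_homB x y : f (x - y) = f x - f y.
Proof. by rewrite -scaleN1r addrC star_homP scaleN1r addrC. Qed.
Lemma star_hom1 : f 1 = 1.
Proof. by case: fP => _ [f1 _] _. Qed.
Lemma star_homM x y : f (x * y) = f x * f y.
Proof. by case: fP => _ [_ fM] _; exact: fM. Qed.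
Lemma star_homS x : f (star x) = star (f x).
Proof. by case: fP => _ _ fs; exact: fs. Qed.
Lemma star_hom_sum I (r : seq I) (P : pred I) (F : I -> A) :
  f (\sum_(k <- r | P k) F k) = \sum_(k <- r | P k) f (F k).
Proof. exact: (big_morph f star_homD star_hom0). Qed.

End StarHom.

Lemma dense_approx (R : realType) (A : cstarType R) (S : set A) (x : A) (e : R) :
  cdense S -> 0 < e -> exists2 y, S y & cnorm (x - y) < e.
Proof.
move=> dS e0.
have [||y [/= xy Sy]] := dS [set y | cnorm (x - y) < e].
- by exists x => /=; rewrite subrr cnorm0.
- rewrite openE => y /= xy.
  apply/(@nbhs_ballP R[i] (normed_copy A)).
  exists (e - cnorm (x - y))%:C%C; first by rewrite /= ltcR subr_gt0.
  move=> z /normed_copy_ball yz.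
  rewrite /= -(subrKA y) (le_lt_trans (cnormD _ _)) //.
  by rewrite -ltrBrDl.
by exists y.
Qed.

Section TensorUniversal.
Variables (R : realType) (A B T D : cstarType R).
Variables (i : A -> T) (j : B -> T) (hT : is_tensor i j).
Variables (p : A -> D) (q : B -> D).
Hypotheses (pP : star_hom p) (qP : star_hom q).
Hypothesis pqC : forall a b, p a * q b = q b * p a.

Let iP : star_hom i. Proof. by case: hT => -[]. Qed.
Let jP : star_hom j. Proof. by case: hT => -[]. Qed.
Let ijC a b : i a * j b = j b * i a. Proof. by case: hT => -[]. Qed.

Let F a : (T * D)%type := (i a, p a).
Let G b : (T * D)%type := (j b, q b).

Let FP : star_hom F.
Proof.
split; [|split|].
- by move=> c x y; rewrite /F !(star_homP iP, star_homP pP).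
- by rewrite /F !(star_hom1 iP, star_hom1 pP).
- by move=> x y; rewrite /F !(star_homM iP, star_homM pP).
- by move=> x; rewrite /F !(star_homS iP, star_homS pP).
Qed.

Let GP : star_hom G.
Proof.
split; [|split|].
- by move=> c x y; rewrite /G !(star_homP jP, star_homP qP).
- by rewrite /G !(star_hom1 jP, star_hom1 qP).
- by move=> x y; rewrite /G !(star_homM jP, star_homM qP).
- by move=> x; rewrite /G !(star_homS jP, star_homS qP).
Qed.

Let FGC a b : F a * G b = G b * F a.
Proof. by congr (_, _); [exact: ijC|exact: pqC]. Qed.

Let fst_sum n (x : 'I_n -> T * D) : (\sum_k x k).1 = \sum_k (x k).1.
Proof. by apply: (big_morph fst). Qed.

(** Injectivity comes from the first component alone. *)
Let embedFG : tensor_embedding F G.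
Proof.
split => // n a b ai /(congr1 fst); rewrite fst_sum => h.
by case: hT => -[_ _ _ inj] _ _; exact: inj ai h.
Qed.

Let span := lspan [set F a * G b | a in [set: A] & b in [set: B]].

(** Uniqueness of the C*-norm, applied to the embedding in T x D; so on the span
    the second component is dominated by the first. *)
Let span_norm e : span e -> cnorm e = cnorm e.1.
Proof.
move=> [n [c [s [Ss ->]]]].
have /choice[ab abE] k : exists ab : A * B, F ab.1 * G ab.2 = s k.
  by have [a _ [b _ <-]] := Ss k; exists (a, b).
have -> : \sum_k c k *: s k = \sum_k F (c k *: (ab k).1) * G (ab k).2.
  by apply: eq_bigr => k _; rewrite (star_homZ FP) -scalerAl abE.
by rewrite fst_sum; case: hT => _ _ /(_ _ _ _ embedFG n); exact.
Qed.

Let span_mul x y : span x -> span y -> span (x * y).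
Proof.
move=> xS yS; move: x xS; apply: lspan_ind => [|c s x [a _ [b _ <-]] xy].
  by rewrite mul0r; exact: lspan0.
rewrite mulrDl -scalerAl; apply: lspan_lin => //.
move: y yS {xy}; apply: lspan_ind => [|d s' y [a' _ [b' _ <-]] yS].
  by rewrite mulr0; exact: lspan0.
rewrite mulrDr -scalerAr; apply: lspan_lin => //; apply: lspan_gen.
exists (a * a') => //; exists (b * b') => //.
by rewrite (star_homM FP) (star_homM GP) -!mulrA; congr (_ * _); rewrite !mulrA FGC.
Qed.

Let span_star x : span x -> span (star x).
Proof.
move: x; apply: lspan_ind => [|c s x [a _ [b _ <-]] xS].
  by rewrite star0; exact: lspan0.
rewrite starD starZ; apply: lspan_lin => //; apply: lspan_gen.
exists (star a) => //; exists (star b) => //.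
by rewrite starM -(star_homS FP) -(star_homS GP) FGC.
Qed.

(** The closure of the span is the graph of a contraction from T to D. *)
Let graph (x : T * D) := forall e, 0 < e -> exists2 y, span y & cnorm (x - y) < e.

Let graph_span x : span x -> graph x.
Proof. by move=> xS e e0; exists x => //; rewrite subrr cnorm0. Qed.

Let graph_norm x : graph x -> cnorm x.2 <= cnorm x.1.
Proof.
move=> xG; apply/ler_addgt0Pr => e e0.
have [|y yS xy] := xG (e / 2); first by rewrite divr_gt0.
have h1 : cnorm (y.1 - x.1) < e / 2.
  by rewrite cnorm_distC; exact: le_lt_trans (pnorm1 (x - y)) xy.
have h2 : cnorm (x.2 - y.2) < e / 2 := le_lt_trans (pnorm2 (x - y)) xy.
have h3 : cnorm y.2 <= cnorm y.1 by rewrite -(span_norm yS); exact: pnorm2.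
have := cnormD (x.2 - y.2) y.2; have := cnormD (y.1 - x.1) x.1.
by rewrite !subrK; lra.
Qed.

Let graph_lin c x y : graph x -> graph y -> graph (c *: x + y).
Proof.
move=> xG yG e e0; have cp : 0 < cabs c + 1 by rewrite ltr_wpDl ?cabs_ge0.
have [|x' xS xx] := xG (e / 2 / (cabs c + 1)); first by rewrite !divr_gt0.
have [|y' yS yy] := yG (e / 2); first by rewrite divr_gt0.
exists (c *: x' + y'); first exact: lspan_lin.
rewrite opprD addrACA -scalerBr (splitr e) (le_lt_trans (cnormD _ _)) //.
rewrite ltrD // cnormZr (@le_lt_trans _ _ ((cabs c + 1) * cnorm (x - x'))) //.
  by rewrite ler_wpM2r ?cnorm_ge0 // lerDl.
by rewrite mulrC -ltr_pdivlMr.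
Qed.

Let graph_mul x y : graph x -> graph y -> graph (x * y).
Proof.
move=> xG yG e e0.
have yp : 0 < cnorm y + 1 by rewrite ltr_wpDl ?cnorm_ge0.
have [|x' xS xx] := xG (e / 2 / (cnorm y + 1)); first by rewrite !divr_gt0.
have xp : 0 < cnorm x' + 1 by rewrite ltr_wpDl ?cnorm_ge0.
have [|y' yS yy] := yG (e / 2 / (cnorm x' + 1)); first by rewrite !divr_gt0.
exists (x' * y'); first exact: span_mul.
have -> : x * y - x' * y' = (x - x') * y + x' * (y - y').
  by rewrite mulrBl mulrBr subrKA.
rewrite (splitr e) (le_lt_trans (cnormD _ _)) // ltrD //.
  rewrite (le_lt_trans (cnormM _ _)) //.
  rewrite (@le_lt_trans _ _ (cnorm (x - x') * (cnorm y + 1))) //.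
    by rewrite ler_wpM2l ?cnorm_ge0 // lerDl.
  by rewrite -ltr_pdivlMr.
rewrite (le_lt_trans (cnormM _ _)) //.
rewrite (@le_lt_trans _ _ ((cnorm x' + 1) * cnorm (y - y'))) //.
  by rewrite ler_wpM2r ?cnorm_ge0 // lerDl.
by rewrite mulrC -ltr_pdivlMr.
Qed.

Let graph_star x : graph x -> graph (star x).
Proof.
move=> xG e /xG[y yS xy]; exists (star y); first exact: span_star.
by rewrite -scaleN1r -(@conjCN1 R[i]) -starZ -starD scaleN1r cnorm_star.
Qed.

(** Approximants of t in the span form a Cauchy sequence in T x D by [span_norm]. *)
Let graph_total t : exists y, graph (t, y).
Proof.
have tot : linearly_total [set i a * j b | a in [set: A] & b in [set: B]].
  by case: hT.
have lift x : lspan [set i a * j b | a in [set: A] & b in [set: B]] x ->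
    exists2 y, span y & y.1 = x.
  move: x; apply: lspan_ind => [|c s x [a _ [b _ <-]] [y yS <-]].
    by exists 0 => //; exact: lspan0.
  exists (c *: (F a * G b) + y) => //; apply: lspan_cons => //.
  by exists a => //; exists b.
have /choice[u uP] n : exists y, span y /\ cnorm (t - y.1) < n.+1%:R^-1.
  have [|x /lift[y yS <-] tx] := @dense_approx _ _ _ t (n.+1%:R^-1) tot.
    by rewrite invr_gt0 ltr0n.
  by exists y.
have u1 e : 0 < e -> exists N, forall n, (N <= n)%N -> cnorm (t - (u n).1) < e.
  by move=> /inv_lt[N Ne]; exists N => n /Ne; apply: lt_trans; case: (uP n).
have uc : seq_cauchy (fun n => u n).
  move=> e e0; have [|N Nu] := u1 (e / 2); first by rewrite divr_gt0.
  exists N => m n Nm Nn.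
  have /span_norm -> : span (u m - u n).
    by rewrite addrC -scaleN1r; apply: lspan_lin; case: (uP n); case: (uP m).
  rewrite /= -(subrKA t) (splitr e) (le_lt_trans (cnormD _ _)) // ltrD ?Nu //.
  by rewrite cnorm_distC Nu.
have [l ul] := seq_of_complete uc.
exists l.2 => e e0; have [N1 h1] := u1 e e0; have [N2 h2] := ul e e0.
exists (u (maxn N1 N2)); first by case: (uP (maxn N1 N2)).
rewrite /cnorm /= gt_max h1 ?leq_maxl //= cnorm_distC.
by rewrite (le_lt_trans (pnorm2 (u (maxn N1 N2) - l))) // h2 ?leq_maxr.
Qed.

Let graph_uniq t y y' : graph (t, y) -> graph (t, y') -> y = y'.
Proof.
move=> ty ty'; have := graph_norm (graph_lin (-1) ty ty').
rewrite /= !scaleN1r addNr cnorm0 => h; apply/eqP; rewrite -subr_eq0 -oppr_eq0 opprB.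
rewrite addrC; apply/eqP/cnorm0_eq0/eqP; by rewrite eq_le h cnorm_ge0.
Qed.

Lemma tensor_universal : exists P : T -> D, [/\ star_hom P,
  forall a, P (i a) = p a, forall b, P (j b) = q b &
  forall t, cnorm (P t) <= cnorm t].
Proof.
have [P PG] := choice graph_total.
have g x : graph x -> P x.1 = x.2.
  by case: x => t y h; exact: graph_uniq (PG t) h.
have GF a : graph (F a).
  apply: graph_span; apply: lspan_gen; exists a => //; exists 1 => //.
  by rewrite (star_hom1 GP) mulr1.
have GG b : graph (G b).
  apply: graph_span; apply: lspan_gen; exists 1 => //; exists b => //.
  by rewrite (star_hom1 FP) mul1r.
exists P; split.
- split; [|split|].
  + by move=> c x y; exact: (g _ (graph_lin c (PG x) (PG y))).
  + by have := g _ (GF 1); rewrite /= (star_hom1 iP) (star_hom1 pP).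
  + by move=> x y; exact: (g _ (graph_mul (PG x) (PG y))).
  + by move=> x; exact: (g _ (graph_star (PG x))).
- by move=> a; exact: (g _ (GF a)).
- by move=> b; exact: (g _ (GG b)).
- by move=> t; exact: (graph_norm (PG t)).
Qed.

End TensorUniversal.

(** * Homomorphisms from the universal algebra *)

Section A20.
Variables (R : realType) (A : cstarType R) (z : 'M[A]_3).

Lemma ord3_ind (P : 'I_3 -> Prop) : P ix1 -> P ix2 -> P ix3 -> forall r, P r.
Proof.
move=> h1 h2 h3 [[|[|[|//]]] r3]; [move: h1|move: h2|move: h3];
  by congr (P _); apply: val_inj.
Qed.

Lemma A20_hom (D : cstarType R) (f : A -> D) : star_hom f ->
  A20_relations z -> A20_relations (map_mx f z).
Proof.
move=> fP h.
have fM := star_homM fP; have fS := star_homS fP; have f0 := star_hom0 fP.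
have f1 := star_hom1 fP; have fB := star_homB fP.
split; intros; rewrite !mxE -?fS -?fM -?fB -?f0 -?f1; congr f;
  by case: h => *; eauto.
Qed.

(** Used to lift generators to a C*-subalgebra. *)
Lemma A20_inj (D : cstarType R) (f : A -> D) : star_hom f -> injective f ->
  A20_relations (map_mx f z) -> A20_relations z.
Proof.
move=> fP fI h.
have fM := star_homM fP; have fS := star_homS fP; have f0 := star_hom0 fP.
have f1 := star_hom1 fP; have fB := star_homB fP.
have e r s : f (z r s) = map_mx f z r s by rewrite mxE.
split; intros; apply: fI; rewrite ?fB ?fM ?fS ?fM ?f0 ?f1 ?e;
  by case: h => *; eauto.
Qed.

(** So an operator commuting with the generators commutes with their adjoints. *)
Lemma A20_star_prod : A20_relations z ->
  forall r s, exists r1 s1 r2 s2, star (z r s) = z r1 s1 * z r2 s2.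
Proof.
move=> h; apply: ord3_ind; apply: ord3_ind; do 4 eexists;
  by case: h => *; eauto.
Qed.

Hypothesis hA : is_A20 z.

Lemma A20_ext (D : cstarType R) (f g : A -> D) : star_hom f -> star_hom g ->
  (forall r s, f (z r s) = g (z r s)) -> f = g.
Proof.
move=> fP gP fg; have [zR univ] := hA.
have [h [_ uniq]] := univ D (map_mx f z) (A20_hom fP zR).
transitivity h; first by apply/esym/uniq; split=> // r s; rewrite mxE.
by apply: uniq; split=> // r s; rewrite mxE fg.
Qed.

End A20.

Section CommutantLift.
Variables (R : realType) (A : cstarType R) (z : 'M[A]_3) (hA : is_A20 z).
Variable (H : hilbertType R).
Local Notation BH := (commutant (1 : adjop H)).

Lemma commutant_sub (c : adjop H) (T : commutant c) : in_commutant 1 (opval T).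
Proof. by have [bT _ _] := opvalP T; apply/asboolP; rewrite !mulr1 !mul1r. Qed.

Lemma opval_star (c : adjop H) (T : commutant c) : opval (star T) = adj_star (opval T).
Proof. exact: opstarE. Qed.

(** The generators have their images in the commutant of c, itself a C*-algebra.
    Universality gives a homomorphism into it, and its composite with the
    inclusion is f, as both agree on generators. *)
Lemma A20_commute (f : A -> BH) (c : BH) : star_hom f ->
  (forall r s, f (z r s) * c = c * f (z r s)) -> forall a, f a * c = c * f a.
Proof.
move=> fP fc; have [zR univ] := hA.
have gen_in r s : in_commutant (opval c) (opval (f (z r s))).
  have [bf _ _] := opvalP (f (z r s)).
  apply/asboolP; split; [exact: bf|by have /(congr1 (@opval _ _ _)) := fc r s|].
  rewrite -opval_star -(star_homS fP).
  have [r1 [s1 [r2 [s2 ->]]]] := A20_star_prod zR r s.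
  rewrite (star_homM fP).
  suff /(congr1 (@opval _ _ _)) : f (z r1 s1) * f (z r2 s2) * c =
    c * (f (z r1 s1) * f (z r2 s2)) by [].
  by rewrite -mulrA fc !mulrA fc.
pose incl (T : commutant (opval c)) : BH := Commutant (commutant_sub T).
have inclP : star_hom incl.
  split; [|split|].
  - by move=> d S T; exact: commutant_eq.
  - exact: commutant_eq.
  - by move=> S T; exact: commutant_eq.
  - by move=> T; apply: commutant_eq => x; rewrite opval_star /= opval_star.
have inclI : injective incl.
  by move=> S T /(congr1 (@opval _ _ _)) /= ST; apply: val_inj.
pose w : 'M[commutant (opval c)]_3 := \matrix_(r, s) Commutant (gen_in r s).
have inclw : map_mx incl w = map_mx f z.
  by apply/matrixP => r s; rewrite !mxE; exact: commutant_eq.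
have [|g [[gP gz] _]] := univ _ w.
  by apply: (A20_inj inclP inclI); rewrite inclw; exact: A20_hom.
have fE : f = incl \o g.
  apply: (A20_ext hA fP).
    split; [|split|].
    + by move=> d x y /=; rewrite (star_homP gP) (star_homP inclP).
    + by rewrite /= (star_hom1 gP) (star_hom1 inclP).
    + by move=> x y /=; rewrite (star_homM gP) (star_homM inclP).
    + by move=> x /=; rewrite (star_homS gP) (star_homS inclP).
  move=> r s; rewrite /= gz; have := congr1 (fun M => fun_of_matrix M r s) inclw.
  by rewrite !mxE => ->.
move=> a; apply: val_inj; rewrite fE /=.
by have [_ h _] := opvalP (g a).
Qed.

End CommutantLift.

(** * Coordinate projections *)

Section Projections.
Variables (R : realType) (S : pointedType).
Implicit Types (E : pred S) (p q : pinj S).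
Local Notation BH := (commutant (1 : adjop (l2 R S))).

Fact restrict_pinjP E x y :
  (if E x then Some x else None) = Some y <-> (if E y then Some y else None) = Some x.
Proof.
by split; [case Ex: (E x) => // -[<-]|case Ey: (E y) => // -[<-]];
  rewrite ?Ex ?Ey.
Qed.

Definition restrict_pinj E := Pinj (restrict_pinjP E).

Definition proj E : BH := pinj_op R (restrict_pinj E).

Lemma proj_comm p E : (forall s t, pinj_fun p s = Some t -> E s = E t) ->
  pinj_op R p * proj E = proj E * pinj_op R p.
Proof.
move=> pE; apply: commutant_l2_eq => x s; rewrite /= /pull /= /pull /=.
case st: (pinj_fun p s) => [t|] /=; last by case: (E s); rewrite //= st.
by rewrite -(pE _ _ st); case: (E s); rewrite //= st.
Qed.

Lemma proj_comm2 p q E :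
  (forall s t u, pinj_fun p s = Some t -> pinj_fun q t = Some u -> E s = E u) ->
  pinj_op R p * pinj_op R q * proj E = proj E * (pinj_op R p * pinj_op R q).
Proof.
move=> pE; apply: commutant_l2_eq => x s; rewrite /= /pull /= /pull /=.
case st: (pinj_fun p s) => [t|] /=; last by case: (E s); rewrite //= st.
rewrite /pull /=; case tu: (pinj_fun q t) => [u|] /=; last first.
  by case: (E s); rewrite //= st /= tu.
by rewrite /pull -(pE _ _ _ st tu); case: (E s); rewrite //= st /= tu.
Qed.

Lemma proj_mul0 E F : (forall s, ~~ (E s && F s)) -> proj E * proj F = 0.
Proof.
move=> EF; apply: commutant_l2_eq => x s; rewrite /= /pull /=.
by have := EF s; case: (E s) => //=; rewrite /pull /=; case: (F s).
Qed.

End Projections.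

Section SU0Commute.
Variables (R : realType) (D : cstarType R).

Lemma su0_comm (a b c : D) : a * c = c * a -> b * c = c * b ->
  star a * c = c * star a -> star b * c = c * star b ->
  forall r s, su0_mx a b r s * c = c * su0_mx a b r s.
Proof.
move=> ac bc a'c b'c; apply: ord3_ind; apply: ord3_ind; rewrite !mxE /=;
  by rewrite ?(ac, bc, a'c, b'c, mul0r, mulr0, mul1r, mulr1).
Qed.

End SU0Commute.

(** * Two commuting representations on l2(N x Z x N) *)

Section Representations.
Variable R : realType.
Local Notation S := (nat * int * nat)%type.
Local Notation BH := (commutant (1 : adjop (l2 R S))).

Definition up1 (s : S) : option S := let: (i, k, j) := s in Some (i.+1, k, j).
Definition down1 (s : S) : option S :=
  let: (i, k, j) := s in if i is i'.+1 then Some (i', k, j) else None.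
Definition up2 (s : S) : option S := let: (i, k, j) := s in Some (i, k, j.+1).
Definition down2 (s : S) : option S :=
  let: (i, k, j) := s in if j is j'.+1 then Some (i, k, j') else None.
Definition turn (n : int) (s : S) : option S :=
  let: (i, k, j) := s in if i is 0%N then Some (0%N, k + n, j) else None.

Fact shift1P x y : up1 x = Some y <-> down1 y = Some x.
Proof.
by case: x y => [[i k] j] [[[|i'] k'] j']; split=> //= -[<- <- <-].
Qed.
Fact shift2P x y : up2 x = Some y <-> down2 y = Some x.
Proof.
by case: x y => [[i k] j] [[i' k'] [|j']]; split=> //= -[<- <- <-].
Qed.
Fact turnP x y : turn (-1) x = Some y <-> turn 1 y = Some x.
Proof.
by case: x y => [[[|i] k] j] [[[|i'] k'] j']; split=> //= -[<- <-];
  rewrite ?subrK ?addrK.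
Qed.

Definition shift1 := Pinj shift1P.
Definition shift2 := Pinj shift2P.
Definition turn1 := Pinj turnP.
Definition ground2 := restrict_pinj (fun s : S => s.2 == 0%N).

Definition a1 : BH := pinj_op R shift1.
Definition b1 : BH := pinj_op R turn1.
Definition a2 : BH := pinj_op R shift2.
Definition b2 : BH := pinj_op R ground2.

Ltac pointwise := rewrite /a1 /b1 /a2 /b2 ?pinj_op_star; apply: commutant_l2_eq => x [[i k] j];
  rewrite /= /pull /= /pull /= ?addrfctE.

Lemma rep1_relations : A20_relations (su0_mx a1 b1).
Proof.
by apply: su0_relations; pointwise; case: i => [|i] //=;
  rewrite ?addrK ?subrK ?addr0 ?add0r.
Qed.

Lemma rep2_relations : A20_relations (su0_mx a2 b2).
Proof.
by apply: su0_relations; pointwise; case: j => [|j] //=;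
  rewrite ?addr0 ?add0r.
Qed.

Lemma rep_commute r s r' s' : su0_mx a1 b1 r s * su0_mx a2 b2 r' s' =
  su0_mx a2 b2 r' s' * su0_mx a1 b1 r s.
Proof.
by apply: su0_comm; apply/esym; apply: su0_comm; pointwise;
  case: i => [|i] //=; case: j => [|j].
Qed.

(** The indices reached from (0, 0, 0) under P Delta. Conservation of
    k - max(j - i, 0) under Delta(z12) is what makes the set invariant: its
    image lowers i while i > 0 and j = 0, and raises both k and j once i = 0. *)
Definition orbit (s : S) : bool := let: (i, k, j) := s in k == (j - i)%N%:Z.
Definition fiber (s : S) : bool := let: (i, k, j) := s in (i == 0%N) && (k == -1).

Lemma fiber_orbit : proj R fiber * proj R orbit = 0.
Proof.
apply: proj_mul0 => -[[i k] j] /=.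
by apply/negP => /andP[/andP[_ /eqP ->]].
Qed.

Lemma fiber_rep2 r s : su0_mx a2 b2 r s * proj R fiber = proj R fiber * su0_mx a2 b2 r s.
Proof.
apply: su0_comm; rewrite /a2 /b2 ?pinj_op_star; apply: proj_comm;
  move=> [[i k] j] [[i' k'] j'] /=; try (by case=> <- <-);
  by case: j => [|j] //= [<- <-].
Qed.

(** Each nonzero product occurring in Delta of a generator is the operator of a
    partial injection that preserves the orbit and its complement. *)
Lemma orbit_rep (r s : 'I_3) :
  let y := \sum_(k < 3 | (minn r s <= k <= maxn r s)%N)
    su0_mx a1 b1 r k * su0_mx a2 b2 k s in
  y * proj R orbit = proj R orbit * y.
Proof.
have aa : a1 * a2 * proj R orbit = proj R orbit * (a1 * a2).
  by apply: proj_comm2 => -[[i k] j] t u [<-] [<-] /=.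
have a'a' : star a1 * star a2 * proj R orbit = proj R orbit * (star a1 * star a2).
  rewrite !pinj_op_star; apply: proj_comm2 => -[[[|i] k] j] //= t u [<-] /=.
  by case: j => // j [<-].
have ab : a1 * b2 * proj R orbit = proj R orbit * (a1 * b2).
  by apply: proj_comm2 => -[[i k] [|j]] t u [<-] //= [<-] /=; rewrite sub0n.
have ba' : b1 * star a2 * proj R orbit = proj R orbit * (b1 * star a2).
  rewrite !pinj_op_star; apply: proj_comm2 => -[[[|i] k] [|j]] //= t u [<-] //= [<-] /=.
  by rewrite !subn0 subr_eq -addn1 PoszD.
have b'a : star b1 * a2 * proj R orbit = proj R orbit * (star b1 * a2).
  rewrite !pinj_op_star; apply: proj_comm2 => -[[[|i] k] j] //= t u [<-] //= [<-] /=.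
  by rewrite !subn0 -addn1 PoszD (inj_eq (addIr _)).
have a'b' : star a1 * star b2 * proj R orbit = proj R orbit * (star a1 * star b2).
  rewrite !pinj_op_star; apply: proj_comm2 => -[[[|i] k] [|j]] //= t u [<-] //= [<-] /=.
  by rewrite !sub0n.
move: r s; apply: ord3_ind; apply: ord3_ind; rewrite /= !big_mkcond !big_ord_recl big_ord0 /=;
rewrite !mxE /= ?(mul0r, mulr0, add0r, addr0, mul1r, mulr1) //;
by rewrite ?mulrDl ?mulrDr ?(aa, a'a', ab, ba', b'a, a'b').
Qed.

(** The adjoint of b1 sends e(0,0,0) to e(0,-1,0). *)
Lemma fiber_b1_orbit : proj R fiber * star b1 * proj R orbit != 0.
Proof.
apply/eqP => /(congr1 (fun T : BH => opval T (basis_vec R (0%N, 0, 0%N)) (0%N, -1, 0%N))).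
rewrite pinj_op_star /= /pull /= /pull /= /pull /= /basis_fun addNr eqxx => /eqP.
by rewrite oner_eq0.
Qed.

End Representations.

(** * Failure of density *)

Theorem mainTheorem5 (R : realType) (A T : cstarType R) (z : 'M[A]_3)
    (hA : is_A20 z) (i j : A -> T) (hT : is_tensor i j)
    (Delta : A -> T) (hD : star_hom Delta)
    (hDz : forall r s : 'I_3, Delta (z r s) =
       \sum_(k < 3 | (minn r s <= k <= maxn r s)%N) i (z r k) * j (z k s)) :
  ~ compact_quantum_group i j Delta.
Proof.
move=> [_ _ _ total _].
have [_ univ] := hA.
have [p1 [[p1P p1z] _]] := univ _ _ (rep1_relations R).
have [p2 [[p2P p2z] _]] := univ _ _ (rep2_relations R).
(* First for y a generator, which commutes with the generators under p1. *)
have p1p2 a b : p1 a * p2 b = p2 b * p1 a.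
  apply/esym; apply: (A20_commute hA p2P) => r s; rewrite p2z.
  by apply/esym; apply: (A20_commute hA p1P) => r' s'; rewrite p1z rep_commute.
have [P [PP Pi Pj P_le]] := tensor_universal hT p1P p2P p1p2.
have PDP : star_hom (P \o Delta).
  split; [|split|].
  - by move=> c x y /=; rewrite (star_homP hD) (star_homP PP).
  - by rewrite /= (star_hom1 hD) (star_hom1 PP).
  - by move=> x y /=; rewrite (star_homM hD) (star_homM PP).
  - by move=> x /=; rewrite (star_homS hD) (star_homS PP).
set Q := proj R fiber; set O := proj R orbit.
have orbitD b : P (Delta b) * O = O * P (Delta b).
  apply: (A20_commute hA PDP) => r s /=; rewrite hDz (star_hom_sum PP).
  under eq_bigr do rewrite (star_homM PP) Pi Pj p1z p2z.
  exact: orbit_rep.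
have fiberj a : Q * p2 a = p2 a * Q.
  by apply/esym; apply: (A20_commute hA p2P) => r s; rewrite p2z fiber_rep2.
(* P Y maps the orbit subspace into the complement of the fiber. *)
have kill Y : lspan [set j a * Delta b | a in [set: A] & b in [set: A]] Y ->
    Q * P Y * O = 0.
  move: Y; apply: lspan_ind => [|c _ Y [a _ [b _ <-]] Y0].
    by rewrite (star_hom0 PP) mulr0 mul0r.
  rewrite (star_homP PP) mulrDr mulrDl Y0 addr0 -scalerAr -scalerAl.
  rewrite (star_homM PP) Pj mulrA fiberj -!mulrA orbitD (mulrA Q O).
  by rewrite fiber_orbit mul0r mulr0 scaler0.
pose X := i (star (z ix1 ix2)).
have PX : Q * P X * O != 0.
  rewrite /X Pi (star_homS p1P) p1z !mxE /=; exact: fiber_b1_orbit.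
have d_gt0 : 0 < cnorm (Q * P X * O).
  by rewrite lt_neqAle cnorm_ge0 andbT eq_sym; apply: contra_neq PX => /cnorm0_eq0.
have c_gt0 : 0 < cnorm Q * cnorm O + 1.
  by rewrite ltr_wpDl // mulr_ge0 // cnorm_ge0.
have [Y /kill QY XY] := dense_approx X total (divr_gt0 d_gt0 c_gt0).
(* As Q (P Y) O = 0, the nonzero Q (P X) O is controlled by X - Y. *)
have : cnorm (Q * P X * O) <= cnorm Q * cnorm (X - Y) * cnorm O.
  rewrite -[Q * P X * O]subr0 -QY -mulrBl -mulrBr -(star_homB PP).
  rewrite (le_trans (cnormM _ _)) // ler_wpM2r ?cnorm_ge0 //.
  by rewrite (le_trans (cnormM _ _)) // ler_wpM2l ?cnorm_ge0 ?P_le.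
apply/negP; rewrite -ltNge mulrAC.
rewrite (@le_lt_trans _ _ ((cnorm Q * cnorm O + 1) * cnorm (X - Y))) //.
  by rewrite ler_wpM2r ?cnorm_ge0 // lerDl.
by rewrite mulrC -ltr_pdivlMr.
Qed.
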